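(* Let $p\ge3$. Set $G_p(x)=1-x-x^2-\cdots-x^p$ and $F_p(x)=1/G_p(x)$. For $n,k\ge0$ let $\ell_{n,k}$ be the number of linear intervals of height $k$ in $\mathbb{F}_n^p$. Then $$\sum_{n,k\ge0}\ell_{n,k}x^ny^k=F_p(x)\left(1+\frac{x^3y^3(1-x^{p-2})}{1-x}+V_p(x,y)+W_p(x,y)\right),$$ where $$V_p(x,y)=\sum_{\substack{1\le i,j\le p\\ j-i\ge2}}x^jy^{j-i}\left(1+\frac{x+x^2+\cdots+x^{p-(j-i)}}{G_p(x)}\right),$$ $$W_p(x,y)=\frac{y(1-x^p)(x^2-x^{p+1})(1-x^{p+1}y^2)}{(1-x)(1-xy)(1-x^py)G_p(x)}.$$
   Context: A Dyck path of semilength $n\ge 0$ is a lattice path from $(0,0)$ to $(2n,0)$ with steps $U=(1,1)$ and $D=(1,-1)$ that never goes below the $x$-axis; it is identified with its word over $\{U,D\}$. A path avoids a pattern $\alpha$ if $\alpha$ does not occur as a factor (block of consecutive steps). For an integer $p\ge 2$, $\mathcal{F}_n^p$ is the set of Dyck paths of semilength $n$ avoiding $DUU$ and $D^{p+1}$, ordered by the Stanley order: $P\le Q$ iff $P$ lies weakly below $Q$ when both are drawn in the plane; $\mathbb{F}_n^p=(\mathcal{F}_n^p,\le)$. An interval is $[P,Q]=\{R:P\le R\le Q\}$ for $P\le Q$ (including $P=Q$); its height is the length of a maximal chain from $P$ to $Q$; it is linear if any two of its elements are comparable. *)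

(* Defs.v *)
From HB Require Import structures.
From mathcomp Require Import all_boot all_order all_algebra.
From mathcomp Require Import boolp zify.

Set Implicit Arguments.
Unset Strict Implicit.
Unset Printing Implicit Defensive.

Import Order.TTheory GRing.Theory Num.Theory.

Local Open Scope ring_scope.

Record fps (R : Type) := FPS { coefs : nat -> R }.

Lemma fpsP (R : Type) (f g : fps R) : coefs f =1 coefs g -> f = g.
Proof. by case: f g => [f] [g] /= fg; congr FPS; apply/funext. Qed.

HB.instance Definition _ (R : Type) := gen_eqMixin (fps R).
HB.instance Definition _ (R : Type) := gen_choiceMixin (fps R).

Section FpsRing.
Variable R : comNzRingType.
Implicit Types f g h : fps R.

Definition fpsC (c : R) : fps R := FPS (fun n => if n is 0%N then c else 0).
Definition fpsX : fps R := FPS (fun n => (n == 1%N)%:R).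

Definition fps_add f g : fps R := FPS (fun n => coefs f n + coefs g n).
Definition fps_opp f : fps R := FPS (fun n => - coefs f n).
Definition fps_mul f g : fps R :=
  FPS (fun n => \sum_(i < n.+1) coefs f i * coefs g (n - i)%N).

Let fps_addA : associative fps_add.
Proof. by move=> f g h; apply: fpsP => n /=; rewrite addrA. Qed.

Let fps_addC : commutative fps_add.
Proof. by move=> f g; apply: fpsP => n /=; rewrite addrC. Qed.

Let fps_add0 : left_id (fpsC 0) fps_add.
Proof. by move=> f; apply: fpsP => -[|n] /=; rewrite add0r. Qed.

Let fps_addN : left_inverse (fpsC 0) fps_opp fps_add.
Proof. by move=> f; apply: fpsP => -[|n] /=; rewrite addNr. Qed.

HB.instance Definition _ :=
  GRing.isZmodule.Build (fps R) fps_addA fps_addC fps_add0 fps_addN.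

Let trunc N f : {poly R} := \poly_(i < N.+1) coefs f i.

Let coef_trunc N f n : (n <= N)%N -> (trunc N f)`_n = coefs f n.
Proof. by move=> nN; rewrite coef_poly ltnS nN. Qed.

Let coef_mul_trunc N f g n : (n <= N)%N ->
  coefs (fps_mul f g) n = (trunc N f * trunc N g)`_n.
Proof.
move=> nN; rewrite coefM /=; apply: eq_bigr => i _.
rewrite !coef_trunc ?(leq_trans (leq_subr _ _)) //.
by rewrite (leq_trans _ nN) // -ltnS.
Qed.

Let fps_mulA : associative fps_mul.
Proof.
move=> f g h; apply: fpsP => n.
transitivity ((trunc n f * (trunc n g * trunc n h))`_n).
  rewrite coefM; apply: eq_bigr => i _; rewrite (coef_trunc f (ltn_ord i : (i <= n)%N)).
  by rewrite (coef_mul_trunc _ _ (leq_subr i n)).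
rewrite mulrA coefM; apply: eq_bigr => i _.
rewrite (coef_trunc h (leq_subr i n)).
by rewrite (coef_mul_trunc f g (ltn_ord i : (i <= n)%N)).
Qed.

Let fps_mulC : commutative fps_mul.
Proof.
by move=> f g; apply: fpsP => n; rewrite !(coef_mul_trunc _ _ (leqnn n)) mulrC.
Qed.

Let fps_mul1 : left_id (fpsC 1) fps_mul.
Proof.
move=> f; apply: fpsP => n /=.
rewrite big_ord_recl /= mul1r subn0 big1 ?addr0 // => i _.
by rewrite mul0r.
Qed.

Let fps_mulDl : left_distributive fps_mul fps_add.
Proof.
move=> f g h; apply: fpsP => n /=.
by rewrite -big_split /=; apply: eq_bigr => i _; rewrite mulrDl.
Qed.

Let fps_one_neq0 : fpsC 1 != 0 :> fps R.
Proof.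
by apply/eqP => /(congr1 (fun f => coefs f 0)) /= /eqP; rewrite oner_eq0.
Qed.

HB.instance Definition _ := GRing.Zmodule_isComNzRing.Build (fps R)
  fps_mulA fps_mulC fps_mul1 fps_mulDl fps_one_neq0.

Lemma coef_fpsD f g n : coefs (f + g) n = coefs f n + coefs g n.
Proof. by []. Qed.

Lemma coef_fpsN f n : coefs (- f) n = - coefs f n.
Proof. by []. Qed.

Lemma coef_fps_sum (I : Type) (r : seq I) (P : pred I) (F : I -> fps R) n :
  coefs (\sum_(i <- r | P i) F i) n = \sum_(i <- r | P i) coefs (F i) n.
Proof.
elim/big_rec2: _ => [|i a b _ <-]; first by case: n.
by rewrite coef_fpsD.
Qed.

Lemma coef_fpsM f g n :
  coefs (f * g) n = \sum_(i < n.+1) coefs f i * coefs g (n - i)%N.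
Proof. by []. Qed.

Lemma coef0_fpsM f g : coefs (f * g) 0 = coefs f 0 * coefs g 0.
Proof. by rewrite coef_fpsM big_ord1. Qed.

Lemma coef_fpsX_lt f k n : coefs f 0 = 0 -> (n < k)%N -> coefs (f ^+ k) n = 0.
Proof.
move=> f0; elim: k n => // k IHk n nk.
rewrite exprS coef_fpsM big_ord_recl f0 mul0r add0r big1 // => i _.
rewrite IHk ?mulr0 //= /bump /=; case: i => i /= lt_in.
by rewrite (leq_trans _ (_ : n <= k)%N) // ltn_subrL add1n /= (leq_ltn_trans _ lt_in).
Qed.

End FpsRing.

Section FpsUnit.
Variable R : comUnitRingType.
Implicit Types f g h : fps R.

Definition fps_unit : pred (fps R) := fun f => coefs f 0 \is a GRing.unit.

(* With a = f(0), 1/f = a^-1 * \sum_k (1 - f / a)^k; only the terms with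
   k <= n contribute to the coefficient of degree n. *)
Definition fps_inv f : fps R :=
  if fps_unit f then
    FPS (fun n => (coefs f 0)^-1 *
      \sum_(k < n.+1) coefs ((1 - fpsC (coefs f 0)^-1 * f) ^+ k) n)
  else f.

Let fps_mulV : {in fps_unit, left_inverse 1 fps_inv *%R}.
Proof.
move=> f fU; rewrite /fps_inv ifT //; apply: fpsP => n.
set a := coefs f 0; set u := 1 - fpsC a^-1 * f.
have u0 : coefs u 0 = 0.
  by rewrite coef_fpsD coef_fpsN coef0_fpsM /= mulVr ?subrr.
pose S := \sum_(k < n.+1) u ^+ k.
have -> : coefs (FPS (fun m => a^-1 * \sum_(k < m.+1) coefs (u ^+ k) m) * f) n
        = coefs (fpsC a^-1 * S * f) n.
  rewrite !coef_fpsM; apply: eq_bigr => i _; congr (_ * _).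
  rewrite coef_fpsM big_ord_recl /= subn0 [X in _ + X]big1 => [|j _]; last first.
    by rewrite mul0r.
  rewrite addr0 coef_fps_sum; congr (_ * _).
  rewrite -!(big_mkord xpredT (fun k => coefs (u ^+ k) i)).
  rewrite [RHS](big_cat_nat (n := i.+1)) //=.
  rewrite [X in _ = _ + X]big_nat [X in _ = _ + X]big1 ?addr0 // => k /andP[ik _].
  exact: coef_fpsX_lt.
have -> : fpsC a^-1 * S * f = (1 - u) * S.
  by rewrite /u opprB addrCA subrr addr0 mulrAC.
rewrite -opprB mulNr -subrX1 opprB coef_fpsD coef_fpsN.
by rewrite coef_fpsX_lt // subr0.
Qed.

Let fps_unitPl f g : g * f = 1 -> fps_unit f.
Proof.
move=> /(congr1 (fun h => coefs h 0)); rewrite coef0_fpsM => gf.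
by apply/unitrPr; exists (coefs g 0); rewrite mulrC.
Qed.

Let fps_inv_out : {in [predC fps_unit], fps_inv =1 id}.
Proof. by move=> f fNU; rewrite /fps_inv ifN. Qed.

HB.instance Definition _ := GRing.ComNzRing_hasMulInverse.Build (fps R)
  fps_mulV fps_unitPl fps_inv_out.

Lemma fps_unitE f : (f \is a GRing.unit) = (coefs f 0 \is a GRing.unit).
Proof. by []. Qed.

End FpsUnit.

Section Intervals.
Variables (d : Order.disp_t) (T : finPOrderType d).
Implicit Types (P Q R : T) (C : {set T}) (k : nat).
Local Open Scope order_scope.

Definition interval_set P Q : {set T} := [set R | P <= R <= Q].

Definition is_chain C : bool := [forall R in C, forall S in C, R >=< S].

Definition maximal_chain P Q C : bool :=
  maxset [pred C' : {set T} | is_chain C' && (C' \subset interval_set P Q)] C.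

(* The length of a chain is its number of steps, one less than its number of
   elements. *)
Definition has_height P Q k : bool :=
  [exists C : {set T}, maximal_chain P Q C && (#|C| == k.+1)].

Definition linear_interval P Q : bool := is_chain (interval_set P Q).

(* A (nonempty) interval is encoded by its pair of endpoints. *)
Definition num_linear_intervals k : nat :=
  #|[set I : T * T | [&& I.1 <= I.2, linear_interval I.1 I.2
                       & has_height I.1 I.2 k]]|.

End Intervals.

Definition U : bool := true.
Definition D : bool := false.

Definition ordinate (w : seq bool) (i : nat) : int :=
  (count_mem U (take i w))%:Z - (count_mem D (take i w))%:Z.

Definition dyck (w : seq bool) : bool :=
  [forall i : 'I_(size w).+1, 0 <= ordinate w i] && (ordinate w (size w) == 0).

Definition avoids (a w : seq bool) : bool := ~~ infix a w.

Definition Fpath_word (p : nat) (w : seq bool) : bool :=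
  [&& dyck w, avoids [:: D; U; U] w & avoids (nseq p.+1 D) w].

Record Fpath (p n : nat) := MkFpath {
  path_word :> n.*2.-tuple bool;
  path_wordP : Fpath_word p path_word
}.

HB.instance Definition _ p n := [isSub for @path_word p n].
HB.instance Definition _ p n := [Finite of Fpath p n by <:].

Fact stanley_display : Order.disp_t. Proof. exact: (Order.Disp tt tt). Qed.

Section Stanley.
Variables p n : nat.
Implicit Types P Q R : Fpath p n.

(* Paths are linear between consecutive integer abscissas, so it suffices to
   compare ordinates there. *)
Definition stanley_le P Q : bool :=
  [forall i : 'I_(n.*2).+1, ordinate P i <= ordinate Q i].

Let stanley_refl : reflexive stanley_le.
Proof. by move=> P; apply/forallP => i. Qed.

Let stanley_anti : antisymmetric stanley_le.
Proof.
move=> P Q /andP[/forallP PQ /forallP QP]; apply/val_inj/val_inj.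
have E i : (i <= n.*2)%N -> ordinate P i = ordinate Q i.
  rewrite -ltnS => lti; apply/eqP; rewrite eq_le.
  by rewrite (PQ (Ordinal lti)) (QP (Ordinal lti)).
apply: (@eq_from_nth _ U); rewrite !size_tuple // => i lti.
have := E i.+1 lti; have := E i (ltnW lti).
rewrite /ordinate !(take_nth U) ?size_tuple // -!cats1 !count_cat /=.
by case: (nth _ _ _); case: (nth _ _ _) => //=; lia.
Qed.

Let stanley_trans : transitive stanley_le.
Proof.
move=> Q P R /forallP PQ /forallP QR; apply/forallP => i.
exact: le_trans (PQ i) (QR i).
Qed.

HB.instance Definition _ := Order.Le_isPOrder.Build stanley_display (Fpath p n)
  stanley_refl stanley_anti stanley_trans.

End Stanley.

(* The ring Z[[y]][[x]], identified with Z[[x,y]]: coefs (coefs f n) k is the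
   coefficient of x^n y^k.  All the series divided by below are units, since
   their constant terms are 1. *)
Definition x : fps (fps int) := fpsX _.
Definition y : fps (fps int) := fpsC (fpsX _).

Definition linear_interval_gf (p : nat) : fps (fps int) :=
  FPS (fun n => FPS (fun k => (num_linear_intervals (Fpath p n) k)%:Z)).

Definition G_ (p : nat) : fps (fps int) := 1 - \sum_(1 <= m < p.+1) x ^+ m.

Definition F_ (p : nat) : fps (fps int) := 1 / G_ p.

Definition V_ (p : nat) : fps (fps int) :=
  \sum_(1 <= i < p.+1) \sum_(1 <= j < p.+1 | (i + 2 <= j)%N)
    x ^+ j * y ^+ (j - i)
    * (1 + (\sum_(1 <= m < (p - (j - i)).+1) x ^+ m) / G_ p).

Definition W_ (p : nat) : fps (fps int) :=
  (y * (1 - x ^+ p) * (x ^+ 2 - x ^+ p.+1) * (1 - x ^+ p.+1 * y ^+ 2))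
  / ((1 - x) * (1 - x * y) * (1 - x ^+ p * y) * G_ p).

(* Main.v *)
Require Import Defs.
From mathcomp Require Import all_boot all_order all_algebra.
From mathcomp Require Import boolp zify ring.

Set Implicit Arguments.
Unset Strict Implicit.
Unset Printing Implicit Defensive.

(* Read backwards, a path of F_n^p is D^e1 U D^e2 U ... D^em U^(n-m+1) for a
   composition (e1, ..., em) of n with parts in [1, p], and the Stanley order
   is the pointwise order of the partial sums of e.  These partial sums form a
   distributive lattice whose covers add 1 to a single partial sum, i.e. move a
   unit from a part to the preceding one.  Let P <= Q, with a common prefix of
   parts stripped, and let c be the first part of P.  If [P, Q] is linear, then
   any element with first part v - 1 lies below any element with first part v;
   comparing extreme ones leaves four shapes of (P, Q): several units move from
   the second part to the first; one unit moves to the first part through a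
   run of parts 1, starting from its far end; the same through a run of parts
   p, starting from its near end; or P = (c, 1, 1) and Q = (c + 2).  So the upper
   ends Q of a given P, weighted by y^height, obey a recursion on the list P,
   and summing over P turns prefixing a part d into multiplication by x^d. *)

(** * Compositions and their partial sums *)

Definition is_comp (p : nat) (e : seq nat) : bool := all (fun d => 0 < d <= p) e.

Definition psum (e : seq nat) (j : nat) : nat := sumn (take j e).

(** These are the partial sum sequences of compositions of n with parts in [1, p], continued by the
    constant n. Infinite sequences make compositions of different lengths comparable pointwise. *)
Record profile (p n : nat) (s : nat -> nat) : Prop := Profile {
  profile0 : s 0 = 0;
  profile_le : forall j, s j <= n;
  profile_mono : forall j, s j <= s j.+1;
  profile_gap : forall j, s j.+1 <= s j + p;
  profile_incr : forall j, s j < n -> s j < s j.+1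
}.

Definition ple (s t : nat -> nat) : Prop := forall j, s j <= t j.

Lemma psum0 e : psum e 0 = 0.
Proof. by rewrite /psum take0. Qed.

Lemma psum_cons d e j : psum (d :: e) j.+1 = d + psum e j.
Proof. by []. Qed.

Lemma psum_le e j : psum e j <= sumn e.
Proof. by rewrite -[in leqRHS](cat_take_drop j e) sumn_cat leq_addr. Qed.

Lemma psum_oversize e j : size e <= j -> psum e j = sumn e.
Proof. by move=> h; rewrite /psum take_oversize. Qed.

Lemma psum_profile p e : is_comp p e -> profile p (sumn e) (psum e).
Proof.
elim: e => [|d e IH] /= => [_|/andP[/andP[d0 dp] /IH [h1 h2 h3 h4 h5]]].
  by split=> // j; rewrite ?leq_addr.
split=> [||[|j]|[|j]|[|j]]; rewrite ?psum_cons ?psum0 ?h1.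
- by [].
- exact: psum_le.
- by [].
- by rewrite leq_add2l.
- lia.
- by rewrite -addnA leq_add2l.
- lia.
- by rewrite !ltn_add2l => /h5.
Qed.

(** Strong induction on n: [s 1] is the first part, and the shifted sequence is a profile for n -
    [s 1]. *)
Lemma profile_comp p n s : profile p n s ->
  exists e, [/\ is_comp p e, sumn e = n & psum e =1 s].
Proof.
have [m] := ubnP n; elim: m n s => // m IH n s nm [h1 h2 h3 h4 h5].
case: (posnP n) => [n0|n0].
  exists [::]; split=> // j; rewrite /psum /=.
  by have := h2 j; lia.
have s1 : 0 < s 1 by rewrite -{1}h1; apply: h5; lia.
have mono j : s 1 <= s j.+1 by elim: j => // j; have := h3 j.+1; lia.
have [||e [he hs hp]] := IH (n - s 1) (fun j => s j.+1 - s 1).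
- have := h2 1; lia.
- split=> [|j|j|j|j]; first by rewrite subnn.
  + by have := h2 j.+1; have := mono j; lia.
  + by have := h3 j.+1; have := mono j; lia.
  + by have := h4 j.+1; have := mono j; lia.
  + by have := h5 j.+1; have := mono j; lia.
exists (s 1 :: e); split=> [|/=|[|j]].
- by rewrite /= he s1 andbT; have := h4 0; rewrite h1.
- by rewrite hs; have := h2 1; lia.
- by rewrite psum0.
- by rewrite psum_cons hp; have := mono j; lia.
Qed.

Lemma psum_inj p e e' : is_comp p e -> is_comp p e' -> psum e =1 psum e' -> e = e'.
Proof.
elim: e e' => [|d e IH] [|d' e'] //=.
- by move=> _ /andP[/andP[d0 _] _] /(_ 1); rewrite psum_cons psum0 /psum /=; lia.
- by move=> /andP[/andP[d0 _] _] _ /(_ 1); rewrite psum_cons psum0 /psum /=; lia.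
- move=> /andP[_ he] /andP[_ he'] h.
  have dd : d = d' by have := h 1; rewrite !psum_cons !psum0 !addn0.
  rewrite dd; congr cons; apply: IH => // j.
  by have := h j.+1; rewrite !psum_cons dd => /addnI.
Qed.

Section Profiles.
Variables p n : nat.
Implicit Types s t : nat -> nat.

(** Every clause of [profile] constrains one value or two consecutive ones, so it survives pointwise
    minima, and likewise maxima: this is the lattice structure. *)
Lemma profile_min s t : profile p n s -> profile p n t ->
  profile p n (fun j => minn (s j) (t j)).
Proof.
move=> [a1 a2 a3 a4 a5] [b1 b2 b3 b4 b5]; split=> [|j|j|j|j]; first by rewrite a1 b1.
all: have := a2 j; have := b2 j; have := a2 j.+1; have := b2 j.+1; have := a3 j;
  have := b3 j; have := a4 j; have := b4 j; have := a5 j; have := b5 j; move=> /=; lia.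
Qed.

Lemma profile_max s t : profile p n s -> profile p n t ->
  profile p n (fun j => maxn (s j) (t j)).
Proof.
move=> [a1 a2 a3 a4 a5] [b1 b2 b3 b4 b5]; split=> [|j|j|j|j]; first by rewrite a1 b1.
all: have := a2 j; have := b2 j; have := a2 j.+1; have := b2 j.+1; have := a3 j;
  have := b3 j; have := a4 j; have := b4 j; have := a5 j; have := b5 j; move=> /=; lia.
Qed.

Lemma profile_grow s i j : profile p n s -> minn n (s i + j) <= s (i + j).
Proof.
move=> [h1 h2 h3 h4 h5]; elim: j => [|j IH]; first by rewrite !addn0 geq_minr.
by rewrite !addnS; have := h5 (i + j); have := h3 (i + j); have := h2 (i + j).+1; lia.
Qed.

Lemma profile_bound s i j : profile p n s -> s (i + j) <= s i + j * p.
Proof.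
move=> [h1 h2 h3 h4 h5]; elim: j => [|j IH]; first by rewrite !addn0.
by rewrite addnS mulSn; have := h4 (i + j); lia.
Qed.

Lemma profile_sat s j : profile p n s -> n <= j -> s j = n.
Proof.
move=> hs nj; have := profile_grow 0 j hs; have := profile_le hs j.
by rewrite (profile0 hs) !add0n; lia.
Qed.

(* Blocked from the right at [j] (gap 1 after it) means that [j.+1] still has
   to move and has a smaller potential; blocked from the left (gap [p] before
   it) means the same for [j.-1].  So a minimum of the potential can move. *)
Lemma profile_cover s t : 1 < p -> profile p n s -> profile p n t -> ple s t ->
  ~ s =1 t ->
  exists j : nat, let r := fun i => s i + (i == j) in [/\ j < n, profile p n r & ple r t].
Proof.
move=> p1 hs ht st nst.
have [j0 hj0] : exists j : 'I_n.+1, s j < t j.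
  apply/existsP; apply: contraT => /existsPn h; case: nst => j.
  case: (leqP n j) => [nj|jn]; first by rewrite !profile_sat.
  by have := h (Ordinal (leqW jn)); have := st j; rewrite /=; lia.
(* Stepping to a blocking neighbour changes the two terms by -2p and p + 1 on the left, by 2 and -(p
   + 1) on the right: a decrease of p - 1 > 0 either way. *)
pose phi (j : 'I_n.+1) := 2 * s j + p.+1 * (n - j).
have [j hj hmin] := @arg_minnP _ j0 (fun j : 'I_n.+1 => s j < t j) phi hj0.
have jn : j < n.
  rewrite ltn_neqAle -ltnS ltn_ord andbT; apply/eqP => jn.
  by move: hj; rewrite !(profile_sat (j := j)) // ?jn ?ltnn.
have j1 : 0 < j by case: posnP hj => // ->; rewrite (profile0 hs) (profile0 ht).
have [h1 h2 h3 h4 h5] := hs; have [b1 b2 b3 b4 b5] := ht.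
have left_free : s j < s j.-1 + p.
  rewrite ltnNge; apply/negP => hl.
  have jn' : j.-1 < n.+1 by lia.
  have := hmin (Ordinal jn'); rewrite /phi /=.
  have -> : n - j.-1 = (n - j).+1 by lia.
  by rewrite mulnS; have := b4 j.-1; rewrite prednK //; lia.
have right_free : s j.+1 = s j + 1 -> s j.+1 = n.
  move=> hr; apply/eqP; rewrite eqn_leq h2 /= leqNgt; apply/negP => hl.
  have jn' : j.+1 < n.+1 by lia.
  have := hmin (Ordinal jn'); rewrite /phi /=.
  have -> : n - j = (n - j.+1).+1 by lia.
  by rewrite mulnS; have := b5 j; have := b2 j.+1; have := b3 j; lia.
exists j; split=> //=; last first.
  by move=> i; have := st i; case: eqP => [->|] /=; lia.
split=> [|i|i|i|i].
- by rewrite h1; case: eqP; lia.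
- by have := h2 i; case: eqP => [->|] /=; have := b2 j; lia.
- case: (eqVneq i j) => [->|] /=.
    by rewrite (gtn_eqF (ltnSn _)); have := h3 j; have := h5 j; have := b2 j; lia.
  by have := h3 i; lia.
- case: (eqVneq i.+1 j) => [ij|] /=; last by have := h4 i; lia.
  by have := left_free; rewrite -ij /=; lia.
- case: (eqVneq i j) => [->|] /=; last by have := h5 i; lia.
  by rewrite (gtn_eqF (ltnSn _)); have := h5 j; have := h3 j; lia.
Qed.

End Profiles.

(** * Shapes of linear intervals *)

Definition lin_prof (p n : nat) (s t : nat -> nat) : Prop :=
  forall r r', profile p n r -> profile p n r' ->
    ple s r -> ple r t -> ple s r' -> ple r' t -> ple r r' \/ ple r' r.

(** [diag] has the partial sums of (c, 1, 1, ...) and [stair] those of (c, p, p, ...), both cut off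
    at n: the lowest profile with first part at least c and the highest with first part at most
    c. *)
Definition diag (n c i : nat) : nat := if i is i'.+1 then minn n (c + i') else 0.

Definition stair (p n c i : nat) : nat := if i is i'.+1 then minn n (c + i' * p) else 0.

Section Classification.
Variables p n : nat.
Implicit Types s t : nat -> nat.

Lemma profile_diag c : 0 < c <= p -> profile p n (diag n c).
Proof. by move=> hc; split=> [|[|j]|[|j]|[|j]|[|j]] //=; lia. Qed.

Lemma profile_stair c : 0 < c <= p -> profile p n (stair p n c).
Proof.
by move=> hc; split=> [|[|j]|[|j]|[|j]|[|j]] //=; rewrite ?mulSn; lia.
Qed.

Lemma ge_diag s c : profile p n s -> c <= s 1 -> ple (diag n c) s.
Proof.
move=> hs cs [|j] //=; have := profile_grow 1 j hs; rewrite add1n; lia.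
Qed.

Lemma le_stair s c : profile p n s -> s 1 <= c -> ple s (stair p n c).
Proof.
move=> hs cs [|j] /=; first by rewrite (profile0 hs).
by have := profile_bound 1 j hs; have := profile_le hs j.+1; rewrite add1n; lia.
Qed.

(* [minn t (stair v.-1)] is the largest element of [[s, t]] with first part
   [v.-1], and [maxn s (diag v)] the smallest one with first part [v]. *)
Lemma lin_prof_key s t v : profile p n s -> profile p n t -> ple s t ->
  lin_prof p n s t -> s 1 < v <= t 1 ->
  forall i, minn (t i) (stair p n v.-1 i) <= maxn (s i) (diag n v i).
Proof.
move=> hs ht st hl /andP[sv vt].
have h1 : 0 < s 1.
  by have := profile_incr hs (j := 0); have := profile_le ht 1; rewrite (profile0 hs); lia.
have tp : t 1 <= p by have := profile_gap ht 0; rewrite (profile0 ht).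
have hd : profile p n (diag n v) by apply: profile_diag; lia.
have hst : profile p n (stair p n v.-1) by apply: profile_stair; lia.
have [] := hl _ _ (profile_min ht hst) (profile_max hs hd).
- by move=> i; rewrite leq_min st /=; apply: le_stair => //; lia.
- by move=> i; rewrite geq_minl.
- by move=> i; rewrite leq_maxl.
- by move=> i; rewrite geq_max st /=; apply: ge_diag.
- by [].
- move=> /(_ 1); rewrite /= mul0n !addn0.
  by have := profile_le ht 1; lia.
Qed.

Lemma profile_head_gt0 s t : profile p n s -> profile p n t -> s 1 < t 1 -> 0 < s 1.
Proof.
move=> hs ht st; have := profile_incr hs (j := 0).
by have := profile_le ht 1; rewrite (profile0 hs); lia.
Qed.

(** [lin_prof_key] with v = c + 1 confines the places where [s] and [t] differ. The alternatives
    are, in order: only the second part gives units, a run of parts 1, a run of parts p, and (c, 1,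
    1) below (c + 2). *)
Lemma lin_prof_cases s t : 2 < p -> profile p n s -> profile p n t -> ple s t ->
  s 1 < t 1 -> lin_prof p n s t ->
  [\/ forall j, s j.+2 = t j.+2,
      forall j, t j = maxn (s j) (diag n (s 1).+1 j),
      t 1 = (s 1).+1 /\ forall j, s j = minn (t j) (stair p n (s 1) j)
    | [/\ s 2 = (s 1).+1, n = (s 1).+2 & t 1 = n]].
Proof.
move=> p3 hs ht st st1 hl; set c := s 1.
have c0 : 0 < c by apply: profile_head_gt0 st1.
have h1 v i : c < v <= t 1 ->
    minn (t i.+1) (minn n (v.-1 + i * p)) <= maxn (s i.+1) (minn n (v + i)).
  by move=> hv; have := lin_prof_key hs ht st hl hv i.+1.
rewrite -/c in st1.
have hsb i : s i.+1 <= c + i * p by have := profile_bound 1 i hs; rewrite add1n.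
have hsg i : minn n (c + i) <= s i.+1 by have := profile_grow 1 i hs; rewrite add1n.
have htg i : minn n (c.+1 + i) <= t i.+1.
  by have := profile_grow 1 i ht; rewrite add1n; lia.
have lesn i := profile_le hs i; have letn i := profile_le ht i.
(* Where they differ beyond the first position, [t] is as low or [s] is as high as the first parts
   allow. Here p >= 3 separates c + 1 + i from c + i * p. *)
have alpha_beta i : 0 < i -> s i.+1 < t i.+1 ->
    t i.+1 = minn n (c.+1 + i) \/ s i.+1 = c + i * p.
  move=> i0 sti; have := h1 c.+1 i; rewrite ltnSn st1 /= => /(_ isT).
  have := hsb i; have := htg i; have := letn i.+1.
  have : i * 3 <= i * p by rewrite leq_mul2l p3 orbT.
  by case: (leqP n (c + i * p)); lia.
have [hA|] := pselect (forall j, s j.+2 = t j.+2); first exact: Or41.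
move=> /existsNP[k /eqP nk].
have [[i i0 [si ti]]|noalpha] :=
    pselect (exists2 i, 0 < i & s i.+1 < t i.+1 /\ t i.+1 = minn n (c.+1 + i)).
  (* With [t] as low as possible at i + 1, [s] is at most c + i there, so its parts 2 to i + 1 are
     all 1. *)
  have s_run j : j <= i -> s j.+1 = c + j.
    move=> ji; have := profile_grow j.+1 (i - j) hs; have := hsg j; have := lesn j.+1.
    by rewrite (_ : j.+1 + (i - j) = i.+1); lia.
  have s2 := s_run 1 i0; have si1 := s_run i (leqnn i).
  (* If [t 1] >= c + 2, then [t 2] <= c + 2 leaves no room for growth after the first part, so [t 1]
     = n = c + 2. *)
  have [t1|t1] := leqP (t 1) c.+1; last first.
    apply: Or44; have := alpha_beta 1 isT; have := htg 1; have := letn 2.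
    have := profile_incr ht (j := 1); have := letn 1; have := letn i.+1.
    by have := profile_mono ht 1; rewrite mul1n; split; lia.
  apply: Or42 => -[|j] /=; first by rewrite (profile0 hs) (profile0 ht).
  have [->|j0] := posnP j; first by have := letn 1; rewrite -/c; lia.
  have := st j.+1; rewrite leq_eqVlt => /orP[/eqP e|stj].
    by have := htg j; lia.
  have [tj|] := alpha_beta j j0 stj; first by lia.
  have : j * 3 <= j * p by rewrite leq_mul2l p3 orbT.
  have [ji|ij] := leqP j i; first by have := s_run j ji; lia.
  (* A second part equal to 1 keeps [s] strictly below the stair from there on. *)
  have := profile_bound 2 j.-1 hs; rewrite s2 (_ : 2 + j.-1 = j.+1); last by lia.
  by rewrite -{2 3}(prednK j0) mulSn; lia.
have sk : s k.+2 < t k.+2 by have := st k.+2; lia.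
have beta j : 0 < j -> s j.+1 < t j.+1 -> s j.+1 = c + j * p.
  by move=> j0 sj; have [ta|//] := alpha_beta j j0 sj; case: noalpha; exists j.
(* Reaching the stair at position k + 2 forces every part of [s] from the second up to there to be
   p. *)
have s2 : s 2 = c + p.
  have := beta k.+1 isT sk; have := profile_bound 2 k hs; have := hsb 1.
  by rewrite add2n !mulSn mul0n; lia.
have t2 : c + p < t 2.
  have := beta k.+1 isT sk; have := profile_bound 2 k ht.
  by rewrite add2n mulSn; lia.
(* Otherwise [lin_prof_key] with v = c + 2 fails at position 2: its left side is c + p + 1, its
   right side at most c + p. *)
have t1 : t 1 = c.+1.
  apply/eqP; rewrite eqn_leq st1 andbT leqNgt; apply/negP => t1.
  by have := h1 c.+2 1; rewrite /= t1 s2; have := letn 2; rewrite mul1n; lia.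
apply: Or43; split=> // -[|j] /=; first by rewrite (profile0 hs) (profile0 ht).
have := hsb j; have := lesn j.+1; have := letn j.+1; rewrite -/c.
have [->|j0] := posnP j; first by rewrite t1 mul0n addn0 -/c; lia.
by have := st j.+1; have := beta j j0; lia.
Qed.

(** Elements of the interval agree from the second partial sum on, so the first part orders them. *)
Lemma lin_prof_tail s t : ple s t -> (forall j, s j.+2 = t j.+2) -> lin_prof p n s t.
Proof.
move=> st h r r' hr hr' sr rt sr' r't.
have e j : r j.+2 = r' j.+2.
  by have := sr j.+2; have := sr' j.+2; have := rt j.+2; have := r't j.+2; rewrite h; lia.
case: (leqP (r 1) (r' 1)) => h1; [left|right] => -[|[|j]].
all: rewrite ?(profile0 hr) ?(profile0 hr') // ?e //; exact: ltnW.
Qed.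

(** An element exceeding [s] at i coincides with [t] from i on. It follows [s] up to some position
    and [t] afterwards, and these positions order the elements. *)
Lemma lin_prof_diag s t : profile p n s ->
  (forall j, t j = maxn (s j) (diag n (s 1).+1 j)) -> lin_prof p n s t.
Proof.
move=> hs h r r' hr hr' sr rt sr' r't.
have up q : profile p n q -> ple s q -> ple q t -> forall i j, i <= j -> s i < q i ->
    q j = t j.
  move=> hq sq qt [|i] [|j] //; rewrite ?(profile0 hs) ?(profile0 hq) // => ij sqi.
  have := profile_grow i.+1 (j - i) hq; rewrite (_ : i.+1 + (j - i) = j.+1); last by lia.
  have := sq j.+1; have := qt j.+1; have := qt i.+1; rewrite !h /=.
  by have := profile_grow 1 i hs; rewrite add1n; lia.
have [|/existsNP[i /negP ri]] := pselect (ple r r'); first by left.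
right=> j; rewrite leqNgt; apply/negP => rj.
have [ij|ji] := leqP i j.
  have := up r hr sr rt i j ij; have := sr' i; have := r't j; lia.
have := up r' hr' sr' r't j i (ltnW ji); have := sr j; have := rt i; lia.
Qed.

(** Dual to [lin_prof_diag]: an element below [t] at a positive i coincides with [s] from i on. *)
Lemma lin_prof_stair s t : profile p n t ->
  t 1 = (s 1).+1 -> (forall j, s j = minn (t j) (stair p n (s 1) j)) -> lin_prof p n s t.
Proof.
move=> ht t1 h r r' hr hr' sr rt sr' r't.
have down q : profile p n q -> ple s q -> ple q t -> forall i j, i <= j -> q i < t i ->
    0 < i -> q j = s j.
  move=> hq sq qt [|i] [|j] // ij sqi _.
  have := profile_bound i.+1 (j - i) hq; rewrite (_ : i.+1 + (j - i) = j.+1); last by lia.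
  have := sq j.+1; have := qt j.+1; have := sq i.+1; rewrite (h i.+1) (h j.+1) /=.
  have := profile_bound 1 i ht; rewrite add1n t1.
  have := profile_le hq j.+1; have := profile_le ht i.+1.
  have : j * p = i * p + (j - i) * p by rewrite -mulnDl subnKC.
  by have := profile_le ht j.+1; lia.
have [|/existsNP[i /negP ri]] := pselect (ple r r'); first by left.
right=> j; rewrite leqNgt; apply/negP => rj.
have i0 : 0 < i by case: i ri => //; rewrite (profile0 hr).
have j0 : 0 < j by case: j rj => //; rewrite (profile0 hr').
have [ij|ji] := leqP i j.
  have := down r' hr' sr' r't i j ij; have := rt i; have := sr j; lia.
have := down r hr sr rt j i (ltnW ji); have := r't j; have := sr' i; lia.
Qed.

(** Partial sums from the third on equal n. With c = [s 1], the first two can only be (c, c+1), (c,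
    c+2), (c+1, c+2) or (c+2, c+2), which form a chain. *)
Lemma lin_prof_corner s t : profile p n s -> s 2 = (s 1).+1 -> n = (s 1).+2 ->
  lin_prof p n s t.
Proof.
move=> hs s2 hn r r' hr hr' sr rt sr' r't.
have e q : profile p n q -> ple s q -> forall j, q j.+3 = n.
  move=> hq sq j; have := profile_grow 2 j.+1 hs; have := sq j.+3; have := profile_le hq j.+3.
  by rewrite add2n; lia.
have e3 := e _ hr sr; have e3' := e _ hr' sr'.
have a1 := sr 1; have a2 := sr 2; have a1' := sr' 1; have a2' := sr' 2.
have [b1 b2] := (profile_le hr 1, profile_le hr 2).
have [b1' b2'] := (profile_le hr' 1, profile_le hr' 2).
have [c1 c1'] := (profile_incr hr (j := 1), profile_incr hr' (j := 1)).
have [d1 d1'] := (profile_mono hr 1, profile_mono hr' 1).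
have [h|h] : (r 1 <= r' 1 /\ r 2 <= r' 2) \/ (r' 1 <= r 1 /\ r' 2 <= r 2) by lia.
  by left=> -[|[|[|j]]]; rewrite ?(profile0 hr) ?e3 ?e3' //; case: h.
by right=> -[|[|[|j]]]; rewrite ?(profile0 hr') ?e3 ?e3' //; case: h.
Qed.

End Classification.

(** * Upper ends of the linear intervals above a composition *)

(* What can follow a part that has taken [k] units from the parts [e] that
   follow it; only the last part may be used up. *)
Definition borrow (k : nat) (e : seq nat) : seq (seq nat) :=
  if e is d :: e' then
    if k < d then [:: (d - k) :: e']
    else if (d == k) && nilp e' then [:: [::]] else [::]
  else [::].

(* Effect on [e] of moving one unit to the part before [e], through as many
   parts [1] as necessary ([shift_ones]) or through any number of parts [p]
   ([shift_full], which lists all possibilities). *)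
Fixpoint shift_ones (e : seq nat) : seq nat :=
  if e is d :: e' then
    if 1 < d then d.-1 :: e' else if nilp e' then [::] else d :: shift_ones e'
  else [::].

Fixpoint shift_full (p : nat) (e : seq nat) : seq (seq nat) :=
  if e is d :: e' then
    borrow 1 e ++ (if d == p then [seq p :: q | q <- shift_full p e'] else [::])
  else [::].

(** The four pieces are the alternatives of [lin_prof_cases]. A run of length 0 already occurs as
    [borrow 1], so the run pieces require a leading 1 that is not last, or a leading p. *)
Definition uppers_head (p c : nat) (e : seq nat) : seq (seq nat) :=
  [seq c + k :: q | k <- iota 1 (p - c), q <- borrow k e] ++
  (if c < p then
     if e is d :: e' then
       (if (d == 1) && ~~ nilp e' then [:: c.+1 :: shift_ones e] else [::]) ++
       (if d == p then [seq c.+1 :: p :: q | q <- shift_full p e'] else [::]) ++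
       (if (c.+2 <= p) && (e == [:: 1; 1]) then [:: [:: c.+2]] else [::])
     else [::]
   else [::]).

Fixpoint uppers (p : nat) (e : seq nat) : seq (seq nat) :=
  if e is c :: e' then [seq c :: q | q <- uppers p e'] ++ uppers_head p c e'
  else [:: [::]].

Definition lin_comp (p : nat) (e e' : seq nat) : Prop :=
  lin_prof p (sumn e) (psum e) (psum e').

(** * Correctness of the list of upper ends *)

Section Uppers.
Variable p : nat.
Implicit Types e q : seq nat.

Lemma psum_sumn e e' k : (forall j, psum e j.+1 = k + psum e' j.+1) ->
  sumn e = k + sumn e'.
Proof.
move=> /(_ (maxn (size e) (size e'))).
by rewrite !psum_oversize //; lia.
Qed.

Lemma psum_const0 e : is_comp p e -> (forall j, psum e j = 0) -> e = [::].
Proof. by move=> he h; apply: (psum_inj he (isT : is_comp p [::])) => j; rewrite h. Qed.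

Lemma comp_sumn0 e : is_comp p e -> sumn e = 0 -> e = [::].
Proof. by move=> he h; apply: psum_const0 => // j; have := psum_le e j; lia. Qed.

Lemma borrowP k e q : is_comp p e -> 0 < k -> k < p ->
  (q \in borrow k e) <-> is_comp p q /\ forall j, psum e j.+1 = k + psum q j.+1.
Proof.
move=> he k0 kp; split.
  case: e he => [|d e] //= /andP[/andP[d0 dp] he].
  case: ltnP => dk.
    rewrite inE => /eqP->; split=> /= [|j]; first by rewrite he; lia.
    by rewrite !psum_cons; lia.
  case: andP => // -[/eqP-> /nilP->]; rewrite inE => /eqP->; split=> // j.
case: e he => [|d e] /= => [_|/andP[/andP[d0 dp] he]] [hq hj].
  by have := hj 0; rewrite {1}/psum /=; lia.
case: q hq hj => [|b q] /= => [_|/andP[/andP[b0 bp] hq]] hj.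
  have := hj 0; rewrite psum_cons psum0 [psum [::] _]/psum /= !addn0 => dk.
  have -> : e = [::].
    apply: psum_const0 => // j; have := hj j.
    by rewrite psum_cons [psum [::] _]/psum /= dk; lia.
  by rewrite dk ltnn eqxx.
have dk : d = k + b by have := hj 0; rewrite !psum_cons !psum0; lia.
have -> : e = q.
  apply: (psum_inj he hq) => j; have := hj j; rewrite !psum_cons; lia.
by rewrite ifT; [rewrite dk addKn mem_seq1|lia].
Qed.

(** The successor accounts for the unit handed over: prefixing c + 1 on the left and c on the right
    gives the [diag] alternative of [lin_prof_cases]. *)
Lemma shift_onesP e : 1 < p -> is_comp p e -> 0 < sumn e -> is_comp p (shift_ones e) /\
  forall j, (psum (shift_ones e) j).+1 = maxn (psum e j) (minn (sumn e) j.+1).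
Proof.
move=> p1; elim: e => //= d e IH /andP[/andP[d0 dp] he] _.
case: ltnP => d1.
  split=> /= [|[|j]]; first by rewrite he; lia.
    by rewrite !psum0; lia.
  have := profile_grow 0 j (psum_profile he); rewrite add0n psum0 !psum_cons.
  by have := psum_le e j; lia.
have -> : d = 1 by lia.
case: nilP => [->|/eqP e0].
  by split=> // -[|j]; rewrite /psum //=; lia.
have [|hs hj] := IH he.
  by rewrite lt0n; apply: contraNneq e0 => /(comp_sumn0 he) ->.
split=> /= [|[|j]]; first by rewrite hs; lia.
  by rewrite !psum0; lia.
by rewrite !psum_cons; have := hj j; lia.
Qed.

(** Prefixing c to [e] and c + 1 to [q] gives the [stair] alternative of [lin_prof_cases]. *)
Lemma shift_fullP e q : 1 < p -> is_comp p e -> (q \in shift_full p e) <->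
  [/\ is_comp p q, sumn e = (sumn q).+1 & forall j, psum e j = minn (psum q j).+1 (j * p)].
Proof.
move=> p1; elim: e q => [|d e IH] q /=; first by split=> // -[].
move=> hde; have /andP[/andP[d0 dp] he] := hde.
rewrite mem_cat; split.
  move=> /orP[hb|].
    have [hq hj] := (@borrowP 1 (d :: e) q hde isT p1).1 hb.
    split=> //; first exact: psum_sumn hj.
    move=> [|j]; first by rewrite psum0.
    rewrite hj; have := profile_bound 0 j.+1 (psum_profile hq).
    have := profile_bound 0 j (psum_profile he).
    have := hj j; rewrite psum_cons !psum0 !add0n mulSn; lia.
  case: eqP => // -> /mapP[q' /(IH _ he)[hq hs hj]] ->; split=> /=.
  - by rewrite hq; lia.
  - by rewrite hs; lia.
  - by move=> [|j]; rewrite ?psum0 // !psum_cons hj mulSn; lia.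
move=> [hq hs hj].
case: q hq hs hj => [|b q] /= => [_|/andP[/andP[b0 bp] hq]] hs hj.
  have d1 : d = 1 by lia.
  have e0 : sumn e = 0 by lia.
  by rewrite (comp_sumn0 he e0) d1.
have := hj 1; rewrite !psum_cons !psum0 !addn0 mul1n => db.
have [bp'|pb] := ltnP b p.
  apply/orP; left; have -> : e = q.
    apply: (psum_inj he hq) => j; have := hj j.+1.
    rewrite !psum_cons mulSn; have := profile_bound 0 j (psum_profile hq).
    by rewrite psum0 add0n; lia.
  by rewrite ifT; [rewrite mem_seq1 (_ : d - 1 = b) //|]; lia.
have bE : b = p by lia.
have dE : d = p by lia.
apply/orP; right; rewrite dE eqxx bE; apply: map_f.
apply/IH => //; split=> // [|j]; first by move: hs; rewrite /=; lia.
by have := hj j.+1; rewrite !psum_cons mulSn; lia.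
Qed.


Lemma uppers_head_sound c e x : 2 < p -> is_comp p (c :: e) -> x \in uppers_head p c e ->
  [/\ c < head 0 x, is_comp p x, sumn x = sumn (c :: e), ple (psum (c :: e)) (psum x)
    & lin_comp p (c :: e) x].
Proof.
move=> p3 hce; have /andP[/andP[c0 cp] he] := hce; have hP := psum_profile hce.
rewrite mem_cat => /orP[/allpairsPdep[k [q [hk hb ->]]]|].
  move: hk; rewrite mem_iota => hk.
  have [||hq hj] := (@borrowP k e q he _ _).1 hb; try lia.
  have hle : ple (psum (c :: e)) (psum (c + k :: q)).
    by move=> [|[|j]]; rewrite ?psum_cons ?psum0 ?hj; lia.
  split=> //=.
  - lia.
  - by rewrite hq; lia.
  - by rewrite (psum_sumn hj) addnA.
  - by apply: lin_prof_tail => // j; rewrite !psum_cons hj addnA.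
case: ifP => // cp'; case: e he hce hP => [|d e] // he hce hP.
rewrite !mem_cat => /or3P[].
- case: ifP => // /andP[/eqP d1 e0]; rewrite inE => /eqP ->; rewrite d1 in he hce hP *.
  have [||hs hj] := @shift_onesP (1 :: e) _ he _; try (rewrite /=; lia).
  have hmax j : psum (c.+1 :: shift_ones (1 :: e)) j
      = maxn (psum [:: c, 1 & e] j) (diag (sumn [:: c, 1 & e]) c.+1 j).
    case: j => [|j]; first by rewrite !psum0.
    rewrite psum_cons addSnnS hj psum_cons /= addn_maxr.
    by have := psum_le (1 :: e) j; rewrite /=; lia.
  split=> //.
  + by move: hs; rewrite /=; lia.
  + have := psum_oversize (leqnn (size (c.+1 :: shift_ones (1 :: e)))).
    have := psum_oversize (leqnn (size [:: c, 1 & e])).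
    by have := hj (maxn (size (1 :: e)) (size (shift_ones (1 :: e)))); rewrite !psum_oversize //=; lia.
  + by move=> j; rewrite hmax leq_maxl.
  + by apply: lin_prof_diag => // j; rewrite hmax psum_cons psum0 addn0.
- case: eqP => // dp /mapP[q hq0 ->]; rewrite dp in he hce hP *.
  have : p :: q \in shift_full p (p :: e) by rewrite /= eqxx mem_cat map_f // orbT.
  move=> /shift_fullP[] // => [|hq hs hj]; first lia.
  have hmin j : psum [:: c, p & e] j
      = minn (psum [:: c.+1, p & q] j) (stair p (sumn [:: c, p & e]) c j).
    case: j => [|j]; first by rewrite !psum0.
    rewrite psum_cons hj psum_cons addSnnS /= addn_minr.
    by move: (psum_le (p :: q) j) hs; rewrite /=; lia.
  have sE : sumn [:: c.+1, p & q] = sumn [:: c, p & e] by move: hs; rewrite /=; lia.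
  have hc : is_comp p [:: c.+1, p & q] by move: hq; rewrite /=; lia.
  split=> //.
  + by move=> j; rewrite hmin geq_minl.
  + apply: lin_prof_stair; first by rewrite -sE; exact: psum_profile.
      by rewrite !psum_cons !psum0 !addn0.
    by move=> j; rewrite hmin psum_cons psum0 addn0.
- case: ifP => // /andP[cp2 /eqP[dE eE]]; rewrite inE => /eqP ->; rewrite dE eE in hP *.
  have hle : ple (psum [:: c; 1; 1]) (psum [:: c.+2]).
    by move=> [|[|[|[|j]]]]; rewrite /psum /=; lia.
  split=> //=; try lia.
  by apply: lin_prof_corner; [exact: hP| |]; rewrite /psum /=; lia.
Qed.

Lemma uppers_head_complete c e c' q : 2 < p -> is_comp p (c :: e) -> is_comp p (c' :: q) ->
  sumn (c' :: q) = sumn (c :: e) -> c < c' -> ple (psum (c :: e)) (psum (c' :: q)) ->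
  lin_comp p (c :: e) (c' :: q) -> c' :: q \in uppers_head p c e.
Proof.
move=> p3 hce hcq hs cc hle hl.
have /andP[/andP[c0 cp] he] := hce; have /andP[/andP[c'0 c'p] hq] := hcq.
have hP := psum_profile hce; have hQ := psum_profile hcq.
have inA k : 0 < k -> c' = c + k -> q \in borrow k e -> c' :: q \in uppers_head p c e.
  move=> k0 c'E hb; rewrite mem_cat; apply/orP; left; apply/allpairsPdep.
  by exists k, q; split=> //; [rewrite mem_iota; lia|rewrite c'E].
rewrite hs in hQ.
have [] := lin_prof_cases p3 hP hQ hle _ hl.
- by rewrite !psum_cons !psum0; lia.
- move=> h; apply: (inA (c' - c)); [lia|lia|].
  apply/borrowP => //; [lia|lia|split=> // j].
  by have := h j; rewrite !psum_cons; lia.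
- rewrite psum_cons psum0 addn0 => h.
  have c'E : c' = c.+1 by have := h 1; rewrite !psum_cons !psum0 /=; lia.
  have e0 : 0 < sumn e by move: hs => /=; lia.
  have p2 : 1 < p by lia.
  have [hso hj] := shift_onesP p2 he e0.
  have qE : q = shift_ones e.
    apply: (psum_inj hq hso) => j; apply: succn_inj; rewrite hj.
    by have := h j.+1; rewrite !psum_cons c'E /=; have := psum_le e j; lia.
  case: e he hce hs hP hQ hle hl inA h e0 hso hj qE => [|d e] // he hce hs hP hQ hle hl inA h e0 hso hj.
  (* For d > 1 the run of parts 1 is empty, and for d = 1 as the last part that part is used up:
     both are [borrow 1]. *)
  move=> qE; have [d1|d1] := ltnP 1 d.
    rewrite /= d1 in qE.
    by apply: (inA 1); rewrite ?addn1 //= d1 mem_seq1 subn1 qE.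
  have dE : d = 1 by move: he => /= /andP[]; lia.
  have [e_nil|e_nil] := boolP (nilp e).
    rewrite /= dE e_nil in qE.
    by apply: (inA 1); rewrite ?addn1 //= dE e_nil qE.
  rewrite mem_cat; apply/orP; right; rewrite ifT; last lia.
  by rewrite !mem_cat {1}dE e_nil qE c'E mem_seq1 eqxx.
- rewrite !psum_cons !psum0 !addn0 => -[c'E h].
  have hf : q \in shift_full p e.
    apply/shift_fullP => //; first lia.
    split=> // [|j]; first by move: hs => /=; lia.
    have := h j.+1; rewrite !psum_cons c'E /=; have := psum_le q j; move: hs => /=; lia.
  case: e he hce hs hP hQ hle hl inA h hf => [|d e] // he hce hs hP hQ hle hl inA h.
  rewrite /= mem_cat => /orP[hb|hb]; first by apply: (inA 1); rewrite ?addn1.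
  rewrite mem_cat; apply/orP; right; rewrite ifT; last lia.
  rewrite !mem_cat; apply/orP; right; apply/orP; left.
  by move: hb; case: eqP => // _ /mapP[q' hq' ->]; rewrite c'E map_f.
- rewrite !psum_cons !psum0 !addn0 => -[e1 sE c's]; rewrite /= in sE c's.
  have q0 : q = [::] by apply: (comp_sumn0 hq); move: hs => /=; lia.
  have eE : e = [:: 1; 1].
    case: e he {hce hs hP hQ hle hl inA} e1 sE c's => [|a [|b e]] //=.
    - by rewrite /psum /=; lia.
    - by rewrite psum_cons psum0; lia.
    - rewrite psum_cons psum0 => /and3P[a0 b0 he] e1 sE c's.
      have -> : e = [::] by apply: (comp_sumn0 he); lia.
      by congr [:: _; _]; lia.
  rewrite mem_cat; apply/orP; right; rewrite ifT; last lia.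
  rewrite q0 eE !mem_cat; apply/orP; right; apply/orP; right.
  rewrite eE /= in sE c's; rewrite ifT; last by rewrite eqxx; lia.
  by rewrite mem_seq1 c's; apply/eqP; congr [:: _]; lia.
Qed.

(** Everything between two sequences with first part c also has first part c, so removing it is an
    isomorphism of intervals. *)
Lemma lin_comp_cons c e q : is_comp p (c :: e) -> is_comp p q -> sumn q = sumn e ->
  lin_comp p (c :: e) (c :: q) <-> lin_comp p e q.
Proof.
move=> /andP[/andP[c0 cp] he] hq sE; split=> hl r r' hr hr' er rq er' r'q.
- pose ext (s : nat -> nat) := fun j => if j is j'.+1 then c + s j' else 0.
  have hext s : profile p (sumn e) s -> profile p (sumn (c :: e)) (ext s).
    move=> [h1 h2 h3 h4 h5]; split=> [|[|j]|[|j]|[|j]|[|j]] //=; rewrite ?h1 //; try lia.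
    + by have := h2 j; lia.
    + by have := h3 j; lia.
    + by have := h4 j; lia.
    + by have := h5 j; lia.
  have [] := hl _ _ (hext _ hr) (hext _ hr').
  1-4: by move=> [|j]; rewrite ?psum0 // psum_cons /= leq_add2l.
  + by move=> h; left=> j; have := h j.+1; rewrite /= leq_add2l.
  + by move=> h; right=> j; have := h j.+1; rewrite /= leq_add2l.
- have hd s : ple (psum (c :: e)) s -> ple s (psum (c :: q)) ->
      profile p (sumn (c :: e)) s ->
      (forall j, s j.+1 = c + (s j.+1 - c)) /\ profile p (sumn e) (fun j => s j.+1 - c).
    move=> es sq [h1 h2 h3 h4 h5].
    have s1 : s 1 = c by have := es 1; have := sq 1; rewrite !psum_cons !psum0; lia.
    have hc j : c <= s j.+1 by have := es j.+1; rewrite psum_cons; lia.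
    split=> [j|]; first by have := hc j; lia.
    split=> [|j|j|j|j]; first by rewrite s1 subnn.
    + by have := h2 j.+1; rewrite /=; lia.
    + by have := h3 j.+1; lia.
    + by have := h4 j.+1; lia.
    + by have := h5 j.+1; have := hc j; rewrite /=; lia.
  have [a1 b1] := hd r er rq hr; have [a2 b2] := hd r' er' r'q hr'.
  have := hl _ _ b1 b2; case.
  + by move=> j; have := er j.+1; have := a1 j; rewrite psum_cons; lia.
  + by move=> j; have := rq j.+1; have := a1 j; rewrite psum_cons; lia.
  + by move=> j; have := er' j.+1; have := a2 j; rewrite psum_cons; lia.
  + by move=> j; have := r'q j.+1; have := a2 j; rewrite psum_cons; lia.
  + move=> h; left=> -[|j]; first by rewrite (profile0 hr).
    by have := h j; have := a1 j; have := a2 j; lia.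
  + move=> h; right=> -[|j]; first by rewrite (profile0 hr').
    by have := h j; have := a1 j; have := a2 j; lia.
Qed.

Lemma mem_uppers e q : 2 < p -> is_comp p e -> (q \in uppers p e) <->
  [/\ is_comp p q, sumn q = sumn e, ple (psum e) (psum q) & lin_comp p e q].
Proof.
move=> p3; elim: e q => [|c e IH] q hce.
  rewrite inE; split=> [/eqP->|[hq sq _ _]]; last by rewrite (comp_sumn0 hq sq).
  split=> // r r' hr hr' _ rq _ _; left=> j.
  by have := rq j; rewrite /psum /=; lia.
have he : is_comp p e by case/andP: hce.
rewrite mem_cat; split.
  case/orP => [/mapP[q' /(IH _ he)[hq sq hle hl] ->]|]; last first.
    by move=> /(uppers_head_sound p3 hce)[].
  have hcq : is_comp p (c :: q') by move: hce hq; rewrite /= => /andP[-> _].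
  split=> //=; first by rewrite sq.
    by move=> [|j]; rewrite ?psum0 // !psum_cons leq_add2l.
  by apply/lin_comp_cons.
case: q => [|c' q] [hcq sq hle hl].
  by have /andP[+ _] := hce; move: sq => /=; lia.
have : c <= c' by have := hle 1; rewrite !psum_cons !psum0; lia.
rewrite leq_eqVlt => /orP[/eqP cc|cc]; apply/orP; [left|right].
  rewrite -{}cc in hcq sq hle hl *; have /andP[_ hq] := hcq.
  have sE : sumn q = sumn e by move: sq => /=; lia.
  apply: map_f; apply/IH => //; split=> //.
    by move=> j; have := hle j.+1; rewrite !psum_cons leq_add2l.
  exact: (lin_comp_cons hce hq sE).1 hl.
exact: uppers_head_complete.
Qed.

End Uppers.

(** * Paths as compositions *)

(* For [t = sumn e - size e], the word, read backwards, of the path whose runs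
   of down steps have the parts of [e] as lengths, from right to left. *)
Fixpoint enc (e : seq nat) (t : nat) : seq bool :=
  if e is d :: e' then nseq d D ++ U :: enc e' t else nseq t U.

Definition ups (v : seq bool) (k : nat) : nat := count_mem U (take k v).

(** For j > 0 the j-th U of the encoding is letter number [psum e j + j]; this turns counts of U
    into partial sums. *)
Lemma ups_enc e t i j : j <= size e + t -> (j <= ups (enc e t) i) = (psum e j + j <= i).
Proof.
rewrite /ups; elim: e i j => [|d e IH] i j /= jt.
  rewrite [psum _ _]/psum /= add0n.
  have [it|ti] := leqP i t.
    by rewrite take_nseq // count_nseq mul1n.
  by rewrite take_oversize ?size_nseq ?count_nseq /= ?mul1n; lia.
case: j jt => [|j] jt; first by rewrite psum0.
rewrite psum_cons take_cat size_nseq; case: (ltnP i d) => id.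
  rewrite take_nseq ?(ltnW id) // count_nseq /= mul0n; lia.
rewrite count_cat count_nseq mul0n add0n.
case E : (i - d) => [|k] /=; first by lia.
by rewrite add1n ltnS IH; lia.
Qed.

Lemma size_enc e t : size (enc e t) = sumn e + size e + t.
Proof.
by elim: e => [|d e IH] /=; rewrite ?size_cat /= size_nseq ?IH //; lia.
Qed.

Lemma count_enc e t : count_mem U (enc e t) = size e + t.
Proof.
elim: e => [|d e IH] /=; rewrite ?count_cat /= count_nseq ?IH /=; lia.
Qed.

Lemma size_comp p e : is_comp p e -> size e <= sumn e.
Proof. by elim: e => //= d e IH /andP[/andP[d0 _] /IH]; lia. Qed.

(** The path ends at height 0, so its height at a point is the number of D minus the number of U to
    the right of that point. *)
Lemma ordinate_rev n v i : size v = n.*2 -> count_mem U v = n -> i <= n.*2 ->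
  ordinate (rev v) i = ((n.*2 - i)%:Z - ((ups v (n.*2 - i)) * 2)%:Z)%R.
Proof.
move=> sv cv i2; rewrite /ordinate /ups take_rev sv !count_rev.
set k := n.*2 - i.
have := count_cat (pred1 U) (take k v) (drop k v); rewrite cat_take_drop cv.
have := count_predC (pred1 U) (take k v); rewrite size_takel ?sv ?leq_subr //.
have := count_predC (pred1 U) (drop k v); rewrite size_drop sv.
have -> : count (predC (pred1 U)) (drop k v) = count_mem D (drop k v).
  by apply: eq_count => -[].
move: (count_mem U (drop k v)) (count_mem D (drop k v)) (count_mem U (take k v)).
by move=> a b c; rewrite /k; lia.
Qed.

Lemma dyck_rev n v : size v = n.*2 ->
  dyck (rev v) <-> count_mem U v = n /\ forall k, k <= n.*2 -> ups v k * 2 <= k.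
Proof.
move=> sv.
have hc : (ordinate (rev v) (size (rev v)) == 0%R) = (count_mem U v == n).
  rewrite /ordinate take_size !count_rev.
  have := count_predC (pred1 U) v; rewrite sv.
  have -> : count (predC (pred1 U)) v = count_mem D v by apply: eq_count => -[].
  by move=> h; apply/eqP/eqP; lia.
rewrite /dyck hc size_rev sv; split.
  move=> /andP[/forallP h /eqP cv]; split=> // k kn.
  have kn' : n.*2 - k < n.*2.+1 by lia.
  have := h (Ordinal kn'); rewrite (ordinate_rev sv cv) /=; last by lia.
  by rewrite subKn //; lia.
move=> [cv h]; rewrite cv eqxx andbT; apply/forallP => -[i /= hi].
by rewrite (ordinate_rev sv cv) //; have := h (n.*2 - i); lia.
Qed.

(** Parts are at least 1, so in the reversed word the j-th U comes after at least j letters D. *)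
Lemma enc_dyck p e : is_comp p e -> dyck (rev (enc e (sumn e - size e))).
Proof.
move=> he; have sz := size_comp he.
apply/(@dyck_rev (sumn e)); first by rewrite size_enc; lia.
split=> [|k kn]; first by rewrite count_enc; lia.
have hu : ups (enc e (sumn e - size e)) k <= size e + (sumn e - size e).
  rewrite -count_enc -[in leqRHS](cat_take_drop k (enc e (sumn e - size e))).
  by rewrite count_cat leq_addr.
have := ups_enc k hu; rewrite leqnn => /esym.
have := profile_grow 0 (ups (enc e (sumn e - size e)) k) (psum_profile he).
by rewrite psum0 add0n; lia.
Qed.

(** The factor is DUU reversed. Since parts are positive, every U that precedes some D comes
    directly after a D. *)
Lemma enc_avoids_DUU p e t : is_comp p e -> infix [:: U; U; D] (enc e t) = false.
Proof.
elim: e => [_|d e IH /andP[/andP[d0 dp] he]] /=.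
  by elim: t => // -[|[|t]] // IH; rewrite infix_consl.
elim: d {d0 dp} => [|d IHd]; rewrite infix_consl //= IH // orbF.
case: e he {IH} => [_|[|b] e] //=.
by case: t => [|[|t]].
Qed.

Lemma enc_avoids_D p e t : is_comp p e -> infix (nseq p.+1 D) (enc e t) = false.
Proof.
elim: e => [_|d e IH /andP[/andP[d0 dp] he]] /=.
  by elim: t => // t IH; rewrite [nseq _ _]/= infix_consl.
have pf m : m <= p -> prefix (nseq p.+1 D) (nseq m D ++ U :: enc e t) = false.
  have : m <= p -> m < p.+1 by [].
  move: {d0 dp he IH d}(p.+1) => q mq /mq {mq}.
  by elim: m q => [|m IH] [|q] //= mq; apply: IH.
elim: d dp {d0} => [|d IHd] dp; rewrite infix_consl.
  by rewrite IH // orbF; apply: (pf 0).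
by rewrite (pf d.+1) // IHd // ltnW.
Qed.

(** The U in front of [v] stands for the letter read before, so the hypotheses pass to the rest
    after a block D^d U. A U read first forces only U afterwards, since otherwise UUD would
    occur. *)
Lemma word_enc p v : infix [:: U; U; D] (U :: v) = false -> infix (nseq p.+1 D) v = false ->
  last U v = U -> exists e t, is_comp p e /\ v = enc e t.
Proof.
have [m] := ubnP (size v); elim: m v => // m IH [|[] v] sv hU hD hl.
- by exists [::], 0.
- exists [::], (size v).+1; split=> //=.
  have {hl hD sv hU} : D \notin v.
    apply: contraFN hU => Dv.
    elim: v {sv hD hl} Dv => [|[] v IHv] //.
    by move=> _; apply: prefixW; apply: prefix_prefix [:: U; U; D] v.
  elim: v => [|[] v IHv] //; rewrite inE negb_or => /andP[_ /IHv vE].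
  exact: (congr1 (cons U) vE).
- have hasU : has (pred1 U) (D :: v).
    by apply/hasP; exists U => //; have := mem_last D v; rewrite [last D v]hl.
  set w := D :: v in sv hU hD hl hasU *.
  set d := find (pred1 U) w.
  have dw : d < size w by rewrite -has_find.
  have d0 : 0 < d by [].
  have wE : w = nseq d D ++ U :: drop d.+1 w.
    rewrite -{1}(cat_take_drop d w) (drop_nth D) //.
    have /eqP -> := nth_find D hasU; congr cat.
    apply: (@eq_from_nth _ D); rewrite size_takel ?size_nseq // 1?ltnW // => i hi.
    rewrite nth_take // nth_nseq hi.
    by have := before_find D hi; case: nth.
  have dp : d <= p.
    rewrite leqNgt; apply/negP => pd.
    suff : infix (nseq p.+1 D) w by rewrite hD.
    rewrite wE -(subnKC pd) nseqD -catA; exact: prefixW (prefix_prefix _ _).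
  have [||||e [t [he vE]]] := IH (drop d.+1 w).
  + rewrite size_drop; lia.
  + apply: contraFF hU => h; rewrite wE infix_consl; apply/orP; right.
    exact: infix_suffix_trans h (suffix_suffix _ _).
  + apply: contraFF hD => h; rewrite wE.
    by apply: infix_suffix_trans h _; rewrite -cat_rcons; exact: suffix_suffix.
  + by move: hl; rewrite {1}wE last_cat.
  exists (d :: e), t; split; first by apply/andP; split=> //; apply/andP.
  by rewrite [enc _ _]/= -vE.
Qed.

(** * Heights *)

(* Moving a unit from a part to the preceding one decreases [wt] by 1, so the
   height of a linear interval is the difference of the [wt] of its ends. *)
Fixpoint wt (e : seq nat) : nat := if e is _ :: e' then sumn e' + wt e' else 0.

(** [wt e] is the sum of [sumn e - psum e i] over 1 <= i <= m: the complement, in a rectangle, of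
    the area under the partial sums. *)
Lemma wt_area e m : size e <= m ->
  wt e + \sum_(i < m.+1) psum e i = m * sumn e.
Proof.
elim: e m => [|c e IH] m /=.
  by rewrite muln0 big1 // => i _; rewrite /psum.
case: m => // m em; rewrite big_ord_recl psum0 add0n.
rewrite (eq_bigr (fun i : 'I_m.+1 => c + psum e i)) => [|i _]; last first.
  by rewrite lift0 psum_cons.
rewrite big_split /= sum_nat_const card_ord mulnDr (mulSn m (sumn e)) -(IH m em).
by move: (\sum_(i < m.+1) psum e i) (m.+1 * c) => a b; lia.
Qed.

Lemma wt_area_comp p e : is_comp p e ->
  wt e + \sum_(i < (sumn e).+1) psum e i = sumn e * sumn e.
Proof. by move=> he; apply: wt_area; apply: size_comp he. Qed.

Lemma wt_anti p e q : is_comp p e -> is_comp p q -> sumn q = sumn e ->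
  ple (psum e) (psum q) -> wt q <= wt e ?= iff (q == e).
Proof.
move=> he hq sq hle.
have [a1 a2] := (wt_area_comp he, wt_area_comp hq); rewrite sq in a2.
have [h1 h2] : \sum_(i < (sumn e).+1) psum e i <= \sum_(i < (sumn e).+1) psum q i
    ?= iff [forall i : 'I_(sumn e).+1, psum e i == psum q i].
  by apply: leqif_sum => i _; split.
split; first by lia.
transitivity ([forall i : 'I_(sumn e).+1, psum e i == psum q i]).
  by rewrite -h2; apply/eqP/eqP; lia.
apply/forallP/eqP => [h|->//].
apply: (psum_inj hq he) => j; have [ji|ij] := ltnP j (sumn e).+1.
  by have /eqP := h (Ordinal ji).
by rewrite !psum_oversize //; [have := size_comp he|have := size_comp hq]; lia.
Qed.

Import Order.TTheory.

Section LinearHeight.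
Variables (d : Order.disp_t) (T : finPOrderType d) (w : T -> nat).
Local Open Scope order_scope.
Hypothesis w_anti : forall P Q : T, P < Q -> (w Q < w P)%N.
Hypothesis w_cover : forall P Q : T, P < Q ->
  exists2 R, P < R <= Q & w P = (w R).+1.

(** P is replaced by R one step higher. By linearity every element is comparable to R, and the
    hypotheses on [w] leave nothing strictly between P and R, so only P is lost. *)
Lemma card_linear_interval (P Q : T) : P <= Q -> linear_interval P Q ->
  #|interval_set P Q| = (w P - w Q).+1.
Proof.
have [m] := ubnP (w P); elim: m P => // m IH P wPm PQ lin.
move: (PQ); rewrite le_eqVlt => /orP[/eqP<-|ltPQ].
  rewrite subnn (_ : interval_set P P = [set P]) ?cards1 //.
  by apply/setP => R; rewrite !inE eq_le andbC.
have [R /andP[PR RQ] wR] := w_cover ltPQ.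
have sub S : S \in interval_set R Q -> S \in interval_set P Q.
  by rewrite !inE => /andP[RS ->]; rewrite (le_trans (ltW PR) RS).
have linR : linear_interval R Q.
  apply/forall_inP => S /sub hS; apply/forall_inP => S' /sub hS'.
  by have /forall_inP/(_ S hS)/forall_inP/(_ S' hS') := lin.
have -> : interval_set P Q = P |: interval_set R Q.
  apply/setP => S; rewrite in_setU1; apply/idP/idP => [hS|].
    have hR : R \in interval_set P Q by rewrite inE (ltW PR).
    have /forall_inP/(_ S hS)/forall_inP/(_ R hR) := lin.
    move: hS; rewrite !inE => /andP[PS SQ] /orP[SR|RS]; last by rewrite RS SQ orbT.
    move: SR; rewrite le_eqVlt => /orP[/eqP->|SR]; first by rewrite lexx RQ orbT.
    move: PS; rewrite le_eqVlt => /orP[/eqP->|PS]; first by rewrite eqxx.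
    by have := w_anti PS; have := w_anti SR; lia.
  by case/orP => [/eqP->|/sub//]; rewrite inE lexx.
rewrite cardsU1 IH //; last by lia.
rewrite inE lt_geF //= add1n wR subSn //.
by move: RQ; rewrite le_eqVlt => /orP[/eqP->//|/w_anti/ltnW].
Qed.

(** A linear interval is itself a chain, hence its own unique maximal chain. *)
Lemma has_height_linear (P Q : T) k : P <= Q -> linear_interval P Q ->
  has_height P Q k = (k == w P - w Q)%N.
Proof.
move=> PQ lin.
have hmax C : maximal_chain P Q C = (C == interval_set P Q).
  apply/maxsetP/eqP => [[/= /andP[hc hsub] hm]|->].
    by rewrite (hm (interval_set P Q)) //= subxx andbT.
  split=> [|B /= /andP[_ h1] h2]; first by rewrite /= subxx andbT.
  by apply/eqP; rewrite eqEsubset h1.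
rewrite /has_height; apply/existsP/eqP => [[C]|->].
  by rewrite hmax => /andP[/eqP-> /eqP]; rewrite card_linear_interval // => -[].
by exists (interval_set P Q); rewrite hmax eqxx card_linear_interval // eqxx.
Qed.

End LinearHeight.

(** * Translation of paths, their order and their intervals to compositions *)

Section Paths.
Variables p n : nat.
Implicit Types P Q R : Fpath p n.

Lemma parts_ex P : exists e,
  [/\ is_comp p e, sumn e = n & rev (path_word P) = enc e (n - size e)].
Proof.
have := path_wordP P; move: (path_word P) => w /and3P[hd hU hD].
set v := rev w; have vw : w = rev v :> seq bool by rewrite revK.
have sv : size v = n.*2 by rewrite size_rev size_tuple.
move: hd; rewrite vw => /(dyck_rev sv)[cv hk].
(* Staying above the axis, the path neither ends with U nor starts with D; reversed, this gives the
   first and last side conditions. *)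
have [||| e [t [he vE]]] := @word_enc p v.
- move: hU; rewrite vw /avoids -infix_revLR => /negbTE hU.
  rewrite infix_consl hU orbF.
  case: (v) hk sv => [|[] v'] // hk sv.
  by have := hk 1; rewrite /ups /= take0 /=; move: sv => /=; lia.
- by move: hD; rewrite vw /avoids -infix_revLR rev_nseq => /negbTE.
- case/lastP: (v) sv cv hk => [|v' b] //; rewrite last_rcons size_rcons => sv cv hk.
  have := hk (size v'); rewrite /ups -cats1 take_size_cat //.
  by move: cv {hk}; rewrite -cats1 count_cat /=; case: b => //=; lia.
have [s1 s2] := (size_enc e t, count_enc e t).
rewrite -vE sv in s1; rewrite -vE cv in s2.
exists e; split=> //; first by lia.
by rewrite -/v vE; congr enc; lia.
Qed.

Definition parts P : seq nat := projT1 (cid (parts_ex P)).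

Lemma parts_comp P : is_comp p (parts P).
Proof. by rewrite /parts; case: cid => e []. Qed.

Lemma parts_sum P : sumn (parts P) = n.
Proof. by rewrite /parts; case: cid => e []. Qed.

Lemma parts_enc P : path_word P = rev (enc (parts P) (n - size (parts P))) :> seq bool.
Proof. by rewrite /parts; case: cid => e [_ _ <-] /=; rewrite revK. Qed.

Lemma parts_profile P : profile p n (psum (parts P)).
Proof. by rewrite -(parts_sum P); apply/psum_profile/parts_comp. Qed.

(** Lying higher means having, at every point, fewer or equally many U to the right; so from the
    right each U of Q comes no earlier than that of P, and [ups_enc] gives these positions. *)
Lemma le_parts P Q : (P <= Q)%O <-> ple (psum (parts P)) (psum (parts Q)).
Proof.
pose v R := enc (parts R) (n - size (parts R)).
have sz R : size (parts R) <= n by rewrite -[in leqRHS](parts_sum R) (size_comp (parts_comp R)).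
have cv R : count_mem U (v R) = n by rewrite count_enc; have := sz R; lia.
have sv R : size (v R) = n.*2 by rewrite size_enc parts_sum; have := sz R; lia.
have uv R i j : j <= n -> (j <= ups (v R) i) = (psum (parts R) j + j <= i).
  by move=> jn; apply: ups_enc; have := sz R; lia.
have un R k : ups (v R) k <= n.
  by rewrite -(cv R) -[in leqRHS](cat_take_drop k (v R)) count_cat leq_addr.
have -> : (P <= Q)%O = stanley_le P Q by [].
rewrite /stanley_le !parts_enc -/(v P) -/(v Q); split.
  move=> /forallP h j; have [jn|nj] := leqP j n; last first.
    by rewrite !(profile_sat (parts_profile _)) // ltnW.
  have pn : psum (parts Q) j + j <= n.*2.
    by have := profile_le (parts_profile Q) j; lia.
  (* This abscissa is the start of the j-th up step of Q counted from the right. *)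
  have hi : n.*2 - (psum (parts Q) j + j) < n.*2.+1 by lia.
  have := h (Ordinal hi); rewrite !(ordinate_rev (sv _) (cv _)) /=; try lia.
  rewrite subKn // => hu.
  have : j <= ups (v P) (psum (parts Q) j + j).
    by apply: (@leq_trans (ups (v Q) (psum (parts Q) j + j))); [rewrite uv|lia].
  by rewrite uv // leq_add2r.
move=> h; apply/forallP => -[i /= hi].
rewrite !(ordinate_rev (sv _) (cv _)) //.
suff : ups (v Q) (n.*2 - i) <= ups (v P) (n.*2 - i) by lia.
have := uv Q (n.*2 - i) _ (un Q (n.*2 - i)); rewrite leqnn => /esym h2.
by rewrite uv //; apply: leq_trans h2; rewrite leq_add2r; apply: h.
Qed.

Lemma parts_inj : injective parts.
Proof.
by move=> P Q h; apply/val_inj/val_inj; rewrite /= !parts_enc h.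
Qed.

Lemma parts_surj e : is_comp p e -> sumn e = n -> exists P, parts P = e.
Proof.
move=> he se; have sz := size_comp he.
have sw : size (rev (enc e (n - size e))) == n.*2 by rewrite size_rev size_enc; lia.
have hw : Fpath_word p (rev (enc e (n - size e))).
  rewrite /Fpath_word -{1}se (enc_dyck he) /avoids -!infix_revLR.
  by rewrite rev_nseq (enc_avoids_DUU _ he) (enc_avoids_D _ he).
exists (@MkFpath p n (Tuple sw) hw); set P := MkFpath _.
have := parts_enc P; rewrite /= => /(congr1 rev); rewrite !revK => hE.
have szP := size_comp (parts_comp P); rewrite parts_sum in szP.
apply: (psum_inj (parts_comp P) he) => j.
have [jn|nj] := leqP j n; last first.
  by rewrite !psum_oversize ?parts_sum //; lia.
(* Both compositions encode the same word, so the positions of its letters U give equal partial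
   sums. *)
have h1 i : (psum e j + j <= i) = (psum (parts P) j + j <= i).
  rewrite -(@ups_enc e (n - size e)); last by lia.
  by rewrite hE ups_enc //; lia.
by have := h1 (psum e j + j); have := h1 (psum (parts P) j + j); rewrite !leqnn; lia.
Qed.

Lemma linear_parts P Q : linear_interval P Q <-> lin_comp p (parts P) (parts Q).
Proof.
rewrite /linear_interval /lin_comp parts_sum; split.
  move=> /forall_inP h r r' hr hr' Pr rQ Pr' r'Q.
  have ex s : profile p n s -> exists R, psum (parts R) =1 s.
    move=> /profile_comp[e [he se es]]; have [R RE] := parts_surj he se.
    by exists R; rewrite RE.
  have [[R RE] [R' RE']] := (ex r hr, ex r' hr').
  have : (R >=< R')%O.
    have hR : R \in interval_set P Q.
      by rewrite inE; apply/andP; split; apply/le_parts => j; rewrite RE.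
    have hR' : R' \in interval_set P Q.
      by rewrite inE; apply/andP; split; apply/le_parts => j; rewrite RE'.
    by have /forall_inP/(_ R' hR') := h R hR.
  case/orP => /le_parts hle; [left|right] => j.
    by rewrite -RE -RE'.
  by rewrite -RE -RE'.
move=> h; apply/forall_inP => R; rewrite inE => /andP[/le_parts PR /le_parts RQ].
apply/forall_inP => S; rewrite inE => /andP[/le_parts PS /le_parts SQ].
by have [/le_parts|/le_parts] := h _ _ (parts_profile R) (parts_profile S) PR RQ PS SQ;
  rewrite /Order.comparable => ->; rewrite ?orbT.
Qed.

(** By [profile_cover] one partial sum can be raised by 1 inside the interval, which by
    [wt_area_comp] lowers [wt] by 1. *)
Lemma height_parts P Q k : 1 < p -> (P <= Q)%O -> linear_interval P Q ->
  has_height P Q k = (k == wt (parts P) - wt (parts Q)).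
Proof.
move=> p1; apply: (@has_height_linear _ _ (fun R => wt (parts R))) => {P Q k} P Q.
  rewrite lt_neqAle => /andP[nPQ /le_parts hle].
  have [h1 h2] := wt_anti (parts_comp P) (parts_comp Q) (etrans (parts_sum Q) (esym (parts_sum P))) hle.
  rewrite ltn_neqAle h1 h2 andbT; apply: contra nPQ => /eqP h.
  by apply/eqP/esym/parts_inj.
rewrite lt_neqAle => /andP[nPQ /le_parts hle].
have [|j [jn hr rQ]] := profile_cover p1 (parts_profile P) (parts_profile Q) hle.
  by move=> h; case/eqP: nPQ; apply/parts_inj/(psum_inj (parts_comp P) (parts_comp Q)).
have [e [he se es]] := profile_comp hr; have [R RE] := parts_surj he se.
have PR : (P <= R)%O by apply/le_parts => i; rewrite RE es /= leq_addr.
have wR : wt (parts P) = (wt (parts R)).+1.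
  have := wt_area_comp (parts_comp R); have := wt_area_comp (parts_comp P).
  rewrite !parts_sum RE => <-.
  rewrite (eq_bigr (fun i : 'I_n.+1 => psum (parts P) i + (i == j :> nat)));
    last by move=> i _; rewrite es.
  have jn' : j < n.+1 by lia.
  have -> : \sum_(i < n.+1) (psum (parts P) i + (i == j :> nat)) = (\sum_(i < n.+1) psum (parts P) i).+1.
    rewrite big_split /= -[RHS]addn1; congr addn.
    by rewrite (bigD1 (Ordinal jn')) //= eqxx big1 // => i; rewrite -val_eqE /= => /negbTE->.
  by move: (\sum_(i < _) _) => S; lia.
exists R => //; apply/andP; split; last by apply/le_parts => i; rewrite RE es.
rewrite lt_neqAle PR andbT; apply/eqP => PRE; move: wR; rewrite PRE; lia.
Qed.

End Paths.

(** * Counting by lower end *)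

Section UniqUppers.
Variable p : nat.
Hypothesis p3 : 2 < p.
Implicit Types e q : seq nat.

Lemma uniq_borrow k e : uniq (borrow k e).
Proof. by case: e => [|d e] //=; case: ifP => //; case: ifP. Qed.

Lemma uniq_shift_full e : uniq (shift_full p e).
Proof.
elim: e => [|d e IH] //=; rewrite cat_uniq.
have -> : uniq (if d == p then [seq p :: q | q <- shift_full p e] else [::]).
  by case: ifP => // _; rewrite map_inj_uniq // => a b [].
rewrite (uniq_borrow 1 (d :: e)) andbT /=; apply/hasPn => q.
case: eqP => // -> /mapP[q' _ ->].
by rewrite ifT ?mem_seq1 ?eqseq_cons; lia.
Qed.

(** The pieces are disjoint: a leading 1 that is not last lends nothing, a leading p that lends one
    unit becomes p - 1, and the corner has first part c + 2 instead of c + 1. *)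
Lemma uniq_uppers_head c e : uniq (uppers_head p c e).
Proof.
rewrite /uppers_head cat_uniq; apply/and3P; split.
- apply: allpairs_uniq_dep; first exact: iota_uniq.
    by move=> k _; exact: uniq_borrow.
  by move=> [k q] [k' q'] _ _ /= [/addnI -> ->].
- apply/hasPn => q; case: ifP => // cp.
  case: e => // d e; rewrite !mem_cat => /or3P[].
  + case: ifP => // /andP[/eqP-> e0]; rewrite mem_seq1 => /eqP->.
    apply/negP => /allpairsPdep[k [q' [hk + _]]]; move: hk; rewrite mem_iota => hk.
    by rewrite /= (negbTE e0) andbF ifF //; lia.
  + case: eqP => // -> /mapP[q' _ ->].
    apply/negP => /allpairsPdep[k [q1 [hk hb []]]] ck.
    have k1 : k = 1 by lia.
    by move: hb; rewrite k1 /= ifT ?mem_seq1; [move=> /eqP-> []; lia|lia].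
  + case: ifP => // /andP[_ /eqP[-> ->]]; rewrite mem_seq1 => /eqP->.
    apply/negP => /allpairsPdep[k [q' [hk + _]]]; move: hk; rewrite mem_iota => hk.
    by rewrite /= andbF ifF //; lia.
- case: ifP => // cp; case: e => // d e.
  rewrite !cat_uniq; apply/and5P; split=> //.
  + by case: ifP.
  + apply/hasPn => q; rewrite mem_cat => /orP[].
      case: eqP => // dp _; rewrite dp [p == 1](_ : _ = false) //; lia.
    case: ifP => // _; rewrite mem_seq1 => /eqP->; case: ifP => // _.
    by rewrite mem_seq1 eqseq_cons; lia.
  + by case: ifP => // _; rewrite map_inj_uniq ?uniq_shift_full // => a b [].
  + apply/hasPn => q; case: ifP => // /andP[_ /eqP[-> _]] _.
    by rewrite ifF //; lia.
  + by case: ifP.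
Qed.

Lemma uniq_uppers e : is_comp p e -> uniq (uppers p e).
Proof.
elim: e => [|c e IH] // hce; have /andP[_ he] := hce.
rewrite cat_uniq map_inj_uniq ?IH ?uniq_uppers_head ?andbT //; last by move=> a b [].
apply/hasPn => q hq; apply/negP => /mapP[q' _ qE].
by have [+ _ _ _ _] := uppers_head_sound p3 hce hq; rewrite qE /= ltnn.
Qed.

End UniqUppers.

(** * Enumeration of compositions and of intervals *)

Section Enumeration.
Variable p : nat.

Definition comps n : seq (seq nat) := [seq parts P | P <- enum {: Fpath p n}].

Lemma mem_comps n e : (e \in comps n) = is_comp p e && (sumn e == n).
Proof.
apply/mapP/andP => [[P _ ->]|[he /eqP se]].
  by rewrite parts_comp parts_sum.
by have [P <-] := parts_surj he se; exists P => //; rewrite mem_enum.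
Qed.

Lemma uniq_comps n : uniq (comps n).
Proof. by rewrite map_inj_uniq ?enum_uniq //; apply: parts_inj. Qed.

Lemma perm_comps0 : perm_eq (comps 0) [:: [::]].
Proof.
apply: uniq_perm => //; first exact: uniq_comps.
move=> e; rewrite mem_comps mem_seq1; apply/andP/eqP => [[he /eqP e0]|->//].
exact: comp_sumn0 he e0.
Qed.

Lemma perm_comps n : perm_eq (comps n.+1)
  [seq d :: e | d <- [seq d <- iota 1 p | d <= n.+1], e <- comps (n.+1 - d)].
Proof.
apply: uniq_perm; first exact: uniq_comps.
  apply: allpairs_uniq_dep; first by rewrite filter_uniq // iota_uniq.
    by move=> d _; exact: uniq_comps.
  by move=> [k q] [k' q'] _ _ /= [-> ->].
move=> e; rewrite mem_comps; apply/andP/allpairsPdep.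
  case: e => [|d e] /=; first by case.
  move=> [/andP[dp he] /eqP se]; exists d, e; rewrite mem_filter mem_iota mem_comps he; split=> //; lia.
move=> [d [e' []]]; rewrite mem_filter mem_iota mem_comps => hd /andP[he' /eqP se'] ->.
by rewrite /= he' se'; lia.
Qed.

Lemma num_linear_intervalsE n k : 2 < p -> num_linear_intervals (Fpath p n) k =
  \sum_(e <- comps n) count (fun q => wt e - wt q == k) (uppers p e).
Proof.
move=> p3; rewrite /num_linear_intervals big_map big_enum /=.
transitivity (\sum_(P : Fpath p n) \sum_(Q : Fpath p n)
    ([&& P <= Q, linear_interval P Q & has_height P Q k]%O : nat)).
  by rewrite pair_big /= -sum1dep_card big_mkcond; apply: eq_bigr => -[P Q] _ /=; case: ifP.
apply: eq_bigr => P _.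
have -> : count (fun q => wt (parts P) - wt q == k) (uppers p (parts P)) =
    \sum_(Q : Fpath p n) ((parts Q \in uppers p (parts P)) && (wt (parts P) - wt (parts Q) == k)).
  rewrite -size_filter -(@perm_size _ [seq parts Q | Q <- enum {: Fpath p n} &
      (parts Q \in uppers p (parts P)) && (wt (parts P) - wt (parts Q) == k)]).
    rewrite size_map size_filter -sum1_count big_enum_cond /= big_mkcond.
    by apply: eq_bigr => Q _; case: ifP.
  apply: uniq_perm.
  - rewrite map_inj_uniq; last exact: parts_inj.
    by rewrite filter_uniq ?enum_uniq.
  - by rewrite filter_uniq // uniq_uppers // parts_comp.
  - move=> q; rewrite mem_filter; apply/mapP/andP.
      by move=> [Q]; rewrite mem_filter => /andP[/andP[h1 h2] _] ->; split.
    move=> [hk hq].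
    have [hc hs _ _] := (mem_uppers q p3 (parts_comp P)).1 hq.
    have [Q QE] := parts_surj hc (etrans hs (parts_sum P)).
    by exists Q => //; rewrite mem_filter QE hk hq mem_enum.
apply: eq_bigr => Q _; congr nat_of_bool.
have memE : (parts Q \in uppers p (parts P)) = (P <= Q)%O && linear_interval P Q.
  apply/idP/andP => [/(mem_uppers _ p3 (parts_comp P))[_ _ h1 h2]|[h1 h2]].
    by split; [apply/le_parts|apply/linear_parts].
  apply/mem_uppers => //; first exact: parts_comp.
  by split; [exact: parts_comp|rewrite !parts_sum|apply/le_parts|apply/linear_parts].
rewrite memE -andbA; case: (boolP (P <= Q)%O) => //= PQ.
case: (boolP (linear_interval P Q)) => //= lin.
by rewrite height_parts ?(ltnW p3) // eq_sym.
Qed.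

End Enumeration.

(** * Generating functions *)

Import GRing.Theory.
Local Open Scope ring_scope.

Section Coefficients.
Variable R : comNzRingType.
Implicit Types g : fps R.

Lemma coef_fpsX_mul g n : coefs (fpsX R * g) n = if n is n'.+1 then coefs g n' else 0.
Proof.
rewrite coef_fpsM; case: n => [|n]; first by rewrite big_ord1 mul0r.
rewrite big_ord_recl mul0r add0r big_ord_recl /= mul1r subn1 /= big1 ?addr0 // => i _.
by rewrite mul0r.
Qed.

Lemma coef_fpsXn_mul d g n :
  coefs (fpsX R ^+ d * g) n = if (d <= n)%N then coefs g (n - d) else 0.
Proof.
elim: d n => [|d IH] n; first by rewrite mul1r subn0.
by rewrite exprS -mulrA coef_fpsX_mul; case: n => // n; rewrite IH.
Qed.

Lemma coef_fpsXn d n : coefs (fpsX R ^+ d) n = (n == d)%:R.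
Proof.
rewrite -[_ ^+ _]mulr1 coef_fpsXn_mul; case: (ltngtP n d) => [h|h|->] //=.
  by case E: (n - d)%N => //; move: E => /eqP; rewrite subn_eq0 leqNgt h.
by rewrite subnn.
Qed.

Lemma coef_fpsC_mul a g n : coefs (fpsC a * g) n = a * coefs g n.
Proof.
rewrite coef_fpsM big_ord_recl subn0 big1 ?addr0 // => i _.
by rewrite mul0r.
Qed.

Lemma fpsC_mul a b : fpsC (a * b) = fpsC a * fpsC b :> fps R.
Proof.
by apply: fpsP => n; rewrite coef_fpsC_mul; case: n => //= n; rewrite mulr0.
Qed.

Lemma fpsC_exp a k : fpsC (a ^+ k) = fpsC a ^+ k :> fps R.
Proof. by elim: k => [|k IH]; rewrite ?expr0 // !exprS fpsC_mul IH. Qed.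

End Coefficients.

Section CompositionSeries.
Variable p : nat.
Implicit Types (f g : seq nat -> fps int) (e q : seq nat).

Local Notation Y := (fpsX int).

Definition comp_gf f : fps (fps int) := FPS (fun n => \sum_(e <- comps p n) f e).

Lemma coef_comp_gf f n : coefs (comp_gf f) n = \sum_(e <- comps p n) f e.
Proof. by []. Qed.

Lemma eq_comp_gf f g : (forall e, is_comp p e -> f e = g e) -> comp_gf f = comp_gf g.
Proof.
move=> fg; apply: fpsP => n /=; apply: eq_big_seq => e.
by rewrite mem_comps => /andP[/fg].
Qed.

Lemma comp_gfD f g : comp_gf (fun e => f e + g e) = comp_gf f + comp_gf g.
Proof. by apply: fpsP => n; rewrite coef_fpsD /= big_split. Qed.

Lemma comp_gfZ a f : comp_gf (fun e => a * f e) = fpsC a * comp_gf f.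
Proof. by apply: fpsP => n; rewrite coef_fpsC_mul /= mulr_sumr. Qed.

Lemma comp_gf0 : comp_gf (fun=> 0) = 0.
Proof. by apply: fpsP => n /=; rewrite big1_eq; case: n. Qed.

Lemma comp_gf_sum (I : Type) (r : seq I) (F : I -> seq nat -> fps int) :
  comp_gf (fun e => \sum_(i <- r) F i e) = \sum_(i <- r) comp_gf (F i).
Proof.
elim: r => [|i r IH].
  by rewrite big_nil -comp_gf0; apply: eq_comp_gf => e _; rewrite big_nil.
by rewrite big_cons -IH -comp_gfD; apply: eq_comp_gf => e _; rewrite big_cons.
Qed.

(** A composition is empty or starts with some part d, which contributes x^d. *)
Lemma comp_gf_rec f : comp_gf f =
  fpsC (f [::]) + \sum_(1 <= d < p.+1) x ^+ d * comp_gf (fun e => f (d :: e)).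
Proof.
apply: fpsP => n; rewrite coef_fpsD coef_fps_sum coef_comp_gf.
rewrite [in RHS](eq_bigr (fun d => if (d <= n)%N then
    \sum_(e <- comps p (n - d)) f (d :: e) else 0)); last first.
  by move=> d _; rewrite /x coef_fpsXn_mul.
case: n => [|n].
  rewrite (perm_big _ (perm_comps0 p)) big_seq1 big_nat big1 ?addr0 // => d.
  by rewrite leqn0 lt0n; case: eqP.
rewrite add0r (perm_big _ (perm_comps p n)) big_allpairs_dep big_filter /=.
by rewrite big_mkcond /index_iota subn1.
Qed.

Lemma comp_gf_head j f : (0 < j <= p)%N ->
  comp_gf (fun e => if e is d :: e' then if d == j then f e' else 0 else 0)
  = x ^+ j * comp_gf f.
Proof.
move=> hj; rewrite comp_gf_rec [fpsC _](_ : _ = 0); last by apply: fpsP => -[].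
rewrite add0r (bigD1_seq j) ?iota_uniq //=; last by rewrite mem_index_iota; lia.
rewrite eqxx big1 ?addr0 // => d /negbTE->.
by rewrite comp_gf0 mulr0.
Qed.

Lemma fps_unit1B (R : comUnitRingType) (g : fps R) : coefs g 0 = 0 -> 1 - g \is a GRing.unit.
Proof. by move=> g0; rewrite fps_unitE coef_fpsD coef_fpsN g0 subr0 unitr1. Qed.

Lemma G_unit : G_ p \is a GRing.unit.
Proof.
apply: fps_unit1B; rewrite coef_fps_sum big_nat big1 // => m /andP[m0 _].
by rewrite /x coef_fpsXn ltn_eqF.
Qed.

Lemma comp_gf1 : comp_gf (fun=> 1) = F_ p.
Proof.
have h := comp_gf_rec (fun=> 1).
rewrite -mulr_suml in h.
rewrite /F_ div1r; apply: (mulIr G_unit); rewrite mulVr ?G_unit //.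
rewrite /G_ mulrBr mulr1 [X in _ - X]mulrC {1}h.
by rewrite addrK.
Qed.

Lemma comp_gf_nil : comp_gf (fun e => (nilp e)%:R) = 1.
Proof.
rewrite comp_gf_rec big1 ?addr0; first by apply: fpsP => -[].
by move=> d _; rewrite (@eq_comp_gf _ (fun=> 0)) // comp_gf0 mulr0.
Qed.

(** * Series of the possible moves *)

Definition borrow_num k e : fps int := (size (borrow k e))%:R.

(** A first part below k lends nothing; k itself lends only as the last part, giving x^k; a part k +
    m with m > 0 lends whatever follows, giving x^(k+m) / G. *)
Lemma comp_gf_borrow k : (0 < k < p)%N -> comp_gf (borrow_num k)
  = x ^+ k * (1 + (\sum_(1 <= m < (p - k).+1) x ^+ m) / G_ p).
Proof.
move=> hk; rewrite comp_gf_rec [fpsC _](_ : _ = 0); last by apply: fpsP => -[].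
rewrite add0r (@big_cat_nat _ _ _ k.+1) //=; last lia.
rewrite big_nat_recr; last lia.
rewrite big_nat big1 => [|d hd]; last first.
  rewrite (@eq_comp_gf _ (fun=> 0)) ?comp_gf0 ?mulr0 // => e _.
  by rewrite /borrow_num /= !ifF //; lia.
rewrite /= add0r mulrDr; have -> : comp_gf (fun e => borrow_num k (k :: e)) = 1.
  rewrite -comp_gf_nil; apply: eq_comp_gf => e _.
  by rewrite /borrow_num /= ltnn eqxx /=; case: nilp.
congr (_ + _); rewrite big_nat (eq_bigr (fun d => x ^+ d * F_ p)) => [|d hd]; last first.
  rewrite -comp_gf1; congr (_ * _); apply: eq_comp_gf => e _.
  by rewrite /borrow_num /= ifT //; lia.
rewrite -big_nat -mulr_suml /F_ div1r mulrA; congr (_ / _).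
rewrite -(add1n k) big_addn mulr_sumr subSn; last lia.
by apply: eq_bigr => i _; rewrite -exprD addnC.
Qed.

(** The exponent is the height of the interval from c :: e to (c + 1) :: q with q = [shift_ones e];
    its 1 is the difference of the sums of e and q. [full_weight] follows the same convention. *)
Definition run_weight e : fps int :=
  if nilp e then 0 else Y ^+ (1 + wt e - wt (shift_ones e))%N.

Definition full_weight e : fps int :=
  \sum_(q <- shift_full p e) Y ^+ (1 + wt e - wt q)%N.

Definition upper_weight e : fps int := \sum_(q <- uppers p e) Y ^+ (wt e - wt q)%N.

Definition head_weight c e : fps int :=
  \sum_(q <- uppers_head p c e) Y ^+ (wt (c :: e) - wt q)%N.

Lemma borrow_wt k e q : q \in borrow k e -> (sumn e = k + sumn q)%N /\ wt q = wt e.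
Proof.
case: e => [|d e] //=; case: ltnP => dk.
  by rewrite mem_seq1 => /eqP-> /=; split=> //; lia.
by case: andP => // -[/eqP-> /nilP->]; rewrite mem_seq1 => /eqP->.
Qed.

Lemma shift_ones_wt e : is_comp p e -> ~~ nilp e ->
  (sumn e = (sumn (shift_ones e)).+1)%N /\ (wt (shift_ones e) <= wt e)%N.
Proof.
elim: e => // d e IH /andP[/andP[d0 dp] he] _ /=.
case: ltnP => d1 /=; first by split; lia.
case: (boolP (nilp e)) => [/nilP->|e0] /=; first by split; lia.
by have [] := IH he e0; lia.
Qed.

Lemma shift_full_wt e q : q \in shift_full p e ->
  (sumn e = (sumn q).+1)%N /\ (wt q <= wt e)%N.
Proof.
elim: e q => // d e IH q; rewrite mem_cat => /orP[/(@borrow_wt 1 (d :: e))[-> ->] //|].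
case: eqP => // -> /mapP[q' /IH[h1 h2] ->] /=; lia.
Qed.

Lemma run_weight_rec d e : is_comp p (d :: e) ->
  run_weight (d :: e) = if (d == 1)%N && ~~ nilp e then Y * run_weight e else Y.
Proof.
move=> /andP[/andP[d0 dp] he]; rewrite /run_weight /=; case: ltnP => d1.
  by rewrite ifF /=; [rewrite addnK|lia].
have -> : d = 1%N by lia.
case: (boolP (nilp e)) => [/nilP->|e0] //=.
have [h1 h2] := shift_ones_wt he e0.
by rewrite -exprS; congr (_ ^+ _); lia.
Qed.

Lemma full_weight_rec d e : full_weight (d :: e) =
  Y * borrow_num 1 (d :: e) + (if d == p then Y * full_weight e else 0).
Proof.
rewrite /full_weight big_cat /=; congr (_ + _).
  rewrite (eq_big_seq (fun=> Y)); last first.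
    by move=> q /(@borrow_wt 1 (d :: e))[_ ->]; rewrite addnK.
  by rewrite big_const_seq count_predT iter_addr_0 /borrow_num mulr_natr.
case: eqP => _; last by rewrite big_nil.
rewrite big_map mulr_sumr; apply: eq_big_seq => q /shift_full_wt[h1 h2] /=.
by rewrite -exprS; congr (_ ^+ _); lia.
Qed.

Hypothesis p3 : (2 < p)%N.

Lemma upper_weight_rec c e : is_comp p (c :: e) ->
  upper_weight (c :: e) = upper_weight e + head_weight c e.
Proof.
move=> /andP[_ he]; rewrite /upper_weight [uppers p (c :: e)]/= big_cat big_map.
congr (_ + _); apply: eq_big_seq => q /(mem_uppers q p3 he)[_ sq _ _] /=.
by rewrite sq subnDl.
Qed.

Lemma full_weightE e : full_weight e = Y * borrow_num 1 e
  + (if e is d :: e' then if d == p then Y * full_weight e' else 0 else 0).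
Proof.
case: e => [|d e]; last exact: full_weight_rec.
by rewrite /full_weight big_nil /borrow_num /= mulr0 addr0.
Qed.

(** A form to which [comp_gf] applies termwise; [1 - (nilp e)%:R] is the indicator of nonempty e. *)
Lemma run_weightE e : is_comp p e -> run_weight e = Y * (1 - (nilp e)%:R)
  + (if e is d :: e' then
       if d == 1%N then Y * (run_weight e' - (1 - (nilp e')%:R)) else 0 else 0).
Proof.
case: e => [|d e] he; first by rewrite /run_weight /= subrr mulr0 addr0.
rewrite run_weight_rec //= subr0 mulr1; case: eqP => // _; last by rewrite addr0.
case: (boolP (nilp e)) => [e0|e0] /=; last by rewrite subr0; ring.
by rewrite /run_weight e0 subrr subr0 mulr0 addr0.
Qed.

(** Borrowing k units has height k, passing through a leading 1 or p adds one step to the weight of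
    the rest, and the corner has height 3. The nested matches suit [comp_gf_head]. *)
Lemma head_weightE c e : is_comp p (c :: e) -> head_weight c e =
  \sum_(1 <= k < (p - c).+1) Y ^+ k * borrow_num k e
  + (if (c < p)%N then
      Y * (if e is d :: e' then if d == 1%N then run_weight e' else 0 else 0)
      + Y * (if e is d :: e' then if d == p then full_weight e' else 0 else 0)
      + (if (c.+2 <= p)%N then
           Y ^+ 3 * (if e is d :: e' then if d == 1%N then
             (if e' is d' :: e'' then if d' == 1%N then (nilp e'')%:R else 0 else 0)
           else 0 else 0)
         else 0)
     else 0).
Proof.
move=> /andP[/andP[c0 cp] he]; rewrite /head_weight /uppers_head big_cat; congr (_ + _).
  rewrite big_allpairs_dep /index_iota subSS subn0; apply: eq_bigr => k _ /=.
  rewrite (eq_big_seq (fun=> Y ^+ k)); last first.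
    by move=> q /borrow_wt[-> ->] /=; congr (_ ^+ _); lia.
  by rewrite big_const_seq count_predT iter_addr_0 /borrow_num mulr_natr.
case: ifP => _; last by rewrite big_nil.
case: e he => [|d e he]; first by rewrite big_nil !mulr0 !add0r if_same.
rewrite !big_cat /= addrA; congr (_ + _ + _).
- case: eqP => d1; last by rewrite big_nil mulr0.
  have [e0|e0] := boolP (nilp e); first by rewrite big_nil /run_weight e0 !mulr0.
  have [//|h1 h2] := @shift_ones_wt (d :: e) he _.
  have he' : is_comp p e by case/andP: he.
  have [h3 h4] := shift_ones_wt he' e0.
  rewrite big_seq1 /run_weight d1 /= (negbTE e0) -!exprS; congr (_ ^+ _).
  lia.
- case: eqP => dp; last by rewrite big_nil mulr0.
  rewrite big_map mulr_sumr; apply: eq_big_seq => q /shift_full_wt[h1 h2] /=.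
  by rewrite -exprS; congr (_ ^+ _); lia.
- case: (boolP (c.+1 < p)%N) => cp2 /=; last by rewrite big_nil.
  case: eqP => [[-> ->]|]; first by rewrite big_seq1 mulr1.
  case: eqP => [->|_ _]; last by rewrite big_nil mulr0.
  case: (e) => [|d' e']; first by rewrite big_nil mulr0.
  case: eqP => [->|_ _]; last by rewrite big_nil mulr0.
  by case: nilP => [->//|_ _]; rewrite big_nil mulr0.
Qed.

Lemma yXn k : y ^+ k = fpsC (Y ^+ k).
Proof. by rewrite /y fpsC_exp. Qed.

(** Summing [run_weightE] gives a linear equation for the series, solved here without division. *)
Lemma comp_gf_run : comp_gf run_weight * (1 - x * y) = y * (F_ p - 1) * (1 - x).
Proof.
set B := comp_gf run_weight.
have : B = y * (F_ p - 1) + x * (y * (B - (F_ p - 1))).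
  have nilB : comp_gf (fun e => 1 - (nilp e)%:R) = F_ p - 1.
    by apply: (canRL (addrK _)); rewrite -comp_gf_nil -comp_gfD -comp_gf1;
      apply: eq_comp_gf => e _; rewrite subrK.
  have runB : comp_gf (fun e => run_weight e - (1 - (nilp e)%:R)) = B - (F_ p - 1).
    by apply: (canRL (addrK _)); rewrite -nilB -comp_gfD; apply: eq_comp_gf => e _; rewrite subrK.
  rewrite {1}/B (eq_comp_gf run_weightE) comp_gfD comp_gfZ nilB; congr (_ + _).
  by rewrite comp_gf_head ?expr1 ?comp_gfZ ?runB //; lia.
by move=> BE; rewrite mulrBr mulr1 {1}BE; ring.
Qed.

Lemma comp_gf_full :
  comp_gf full_weight * (1 - x ^+ p * y) = y * comp_gf (borrow_num 1).
Proof.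
set C := comp_gf full_weight.
have CE : C = y * comp_gf (borrow_num 1) + x ^+ p * (y * C).
  rewrite {1}/C (eq_comp_gf (fun e _ => full_weightE e)) comp_gfD comp_gfZ; congr (_ + _).
  by rewrite comp_gf_head ?comp_gfZ //; lia.
by rewrite mulrBr mulr1 {1}CE; ring.
Qed.

Lemma comp_gf_head_weight c : (0 < c <= p)%N -> comp_gf (head_weight c) =
  \sum_(1 <= k < (p - c).+1) y ^+ k * comp_gf (borrow_num k)
  + (if (c < p)%N then
      y * (x * comp_gf run_weight) + y * (x ^+ p * comp_gf full_weight)
      + (if (c.+2 <= p)%N then y ^+ 3 * x ^+ 2 else 0)
    else 0).
Proof.
move=> hc; rewrite (@eq_comp_gf _ _ (fun e he => @head_weightE c e _)); last first.
  by rewrite /= hc.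
rewrite comp_gfD comp_gf_sum; congr (_ + _).
  by apply: eq_bigr => k _; rewrite comp_gfZ yXn.
case: ifP => cp; last exact: comp_gf0.
rewrite !comp_gfD !comp_gfZ !comp_gf_head ?comp_gfZ ?expr1; try lia.
congr (_ + _); case: ifP => cp2; last exact: comp_gf0.
rewrite comp_gfZ comp_gf_head; last lia.
rewrite comp_gf_head; last lia.
by rewrite comp_gf_nil yXn mulr1 !expr1 expr2.
Qed.

(** * Assembling the generating function *)

Lemma linear_interval_gfE : linear_interval_gf p = comp_gf upper_weight.
Proof.
apply: fpsP => n; apply: fpsP => k; rewrite coef_comp_gf coef_fps_sum /=.
rewrite num_linear_intervalsE // (big_morph Posz PoszD (erefl _)).
apply: eq_bigr => e _; rewrite coef_fps_sum -sum1_count big_mkcond /=.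
rewrite (big_morph Posz PoszD (erefl _)); apply: eq_bigr => q _.
by rewrite coef_fpsXn eq_sym; case: eqP.
Qed.

(** Summing [upper_weight_rec] reproduces the series times x + ... + x^p, which [G_] absorbs on the
    left. *)
Lemma upper_gf_rec : G_ p * comp_gf upper_weight
  = 1 + \sum_(1 <= c < p.+1) x ^+ c * comp_gf (head_weight c).
Proof.
rewrite /G_ mulrBl mul1r {1}comp_gf_rec.
have -> : fpsC (upper_weight [::]) = 1 by rewrite /upper_weight big_seq1.
rewrite -addrA; congr (_ + _); apply/eqP; rewrite subr_eq; apply/eqP.
rewrite mulr_suml -big_split; apply: eq_big_nat => c hc /=.
rewrite -mulrDr -comp_gfD; congr (_ * _); apply: eq_comp_gf => e he.
by rewrite upper_weight_rec 1?addrC //=; rewrite he andbT.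
Qed.

Lemma x_geom m : (1 - x) * (\sum_(1 <= c < m.+1) x ^+ c) = x - x ^+ m.+1.
Proof.
elim: m => [|m IH]; first by rewrite big_geq // mulr0 expr1 subrr.
by rewrite big_nat_recr //= mulrDr IH [x ^+ m.+2]exprS; ring.
Qed.


(* The terms [k = 1] of the sum belong to [W_]. *)
Lemma borrow_sum :
  \sum_(1 <= c < p.+1) x ^+ c * (\sum_(1 <= k < (p - c).+1) y ^+ k * comp_gf (borrow_num k))
  = V_ p + (\sum_(1 <= c < p) x ^+ c) * (y * comp_gf (borrow_num 1)).
Proof.
have -> : \sum_(1 <= c < p) x ^+ c = \sum_(1 <= c < p.+1) (if (c < p)%N then x ^+ c else 0).
  rewrite big_nat_recr /=; last lia.
  by rewrite ltnn addr0; apply: eq_big_nat => c /andP[_ ->].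
rewrite mulr_suml -big_split; apply: eq_big_nat => c hc /=.
have widen (F : nat -> fps (fps int)) :
    \sum_(1 <= j < p.+1 | (c + 2 <= j)%N) F j = \sum_(c + 2 <= j < p.+1) F j.
  by rewrite [RHS](@big_nat_widenl _ _ _ _ 1) //; lia.
(* The index j of [V_] is c + k, so j >= c + 2 means k >= 2. *)
rewrite widen [(c + 2)%N]addnC big_addn.
have -> : (p.+1 - c = (p - c).+1)%N by lia.
have step k : (2 <= k < (p - c).+1)%N -> x ^+ c * (y ^+ k * comp_gf (borrow_num k)) =
    x ^+ (k + c) * y ^+ (k + c - c)
      * (1 + (\sum_(1 <= m < (p - (k + c - c)).+1) x ^+ m) / G_ p).
  by move=> hk; rewrite addnK comp_gf_borrow ?exprD; [ring|lia].
case: ltnP => cp; last first.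
  by rewrite mul0r addr0 !big_geq ?mulr0 //; lia.
rewrite big_ltn; last lia.
rewrite mulrDr addrC expr1; congr (_ + _).
by rewrite mulr_sumr; apply: eq_big_nat.
Qed.

End CompositionSeries.

(** Borrowing k >= 2 units gives [V_]; moves of a single unit share the factor y and the range c <
    p; the corner needs c <= p - 2. *)
Lemma head_weight_sum p : (2 < p)%N ->
  \sum_(1 <= c < p.+1) x ^+ c * comp_gf p (head_weight p c)
  = V_ p + (\sum_(1 <= c < p) x ^+ c) * y * (comp_gf p (borrow_num 1)
      + x * comp_gf p run_weight + x ^+ p * comp_gf p (full_weight p))
    + (\sum_(1 <= c < p.-1) x ^+ c) * (y ^+ 3 * x ^+ 2).
Proof.
move=> p3; set K := y ^+ 3 * x ^+ 2.
set M := y * (x * comp_gf p run_weight) + y * (x ^+ p * comp_gf p (full_weight p)).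
transitivity (V_ p + (\sum_(1 <= c < p) x ^+ c) * (y * comp_gf p (borrow_num 1))
    + \sum_(1 <= c < p.+1) x ^+ c *
        (if (c < p)%N then M + (if (c.+2 <= p)%N then K else 0) else 0)).
  rewrite -borrow_sum // -big_split; apply: eq_big_nat => c hc /=.
  by rewrite comp_gf_head_weight // mulrDr.
have -> : \sum_(1 <= c < p.+1) x ^+ c *
        (if (c < p)%N then M + (if (c.+2 <= p)%N then K else 0) else 0)
    = (\sum_(1 <= c < p) x ^+ c) * M + (\sum_(1 <= c < p.-1) x ^+ c) * K.
  rewrite big_nat_recr /=; last lia.
  rewrite ltnn mulr0 addr0.
  rewrite (@eq_big_nat _ _ _ _ _ _ (fun c =>
    x ^+ c * M + x ^+ c * (if (c.+2 <= p)%N then K else 0))); last first.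
    by move=> c /andP[_ ->]; rewrite mulrDr.
  rewrite big_split /= -mulr_suml; congr (_ + _).
  case: p p3 @M => // q q2 M /=; rewrite big_nat_recr /=; last lia.
  rewrite ltnn mulr0 addr0 mulr_suml; apply: eq_big_nat => c hc.
  by rewrite ifT //; lia.
by rewrite /M; ring.
Qed.

Lemma corner_sum p : (2 < p)%N ->
  (\sum_(1 <= c < p.-1) x ^+ c) * (y ^+ 3 * x ^+ 2)
  = x ^+ 3 * y ^+ 3 * (1 - x ^+ (p - 2)) / (1 - x).
Proof.
case: p => [|[|[|m]]] // _; have uX : 1 - x \is a GRing.unit by exact: fps_unit1B.
apply: (mulIr uX); rewrite mulrVK // !subSS subn0.
have := x_geom m.+1; rewrite [x ^+ m.+2]exprS /=; set Q := \sum_(1 <= c < _) _ => QE.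
transitivity ((1 - x) * Q * (y ^+ 3 * x ^+ 2)); first by ring.
by rewrite QE; ring.
Qed.

Lemma W_sum p : (2 < p)%N ->
  (\sum_(1 <= c < p) x ^+ c) * y * (comp_gf p (borrow_num 1)
    + x * comp_gf p run_weight + x ^+ p * comp_gf p (full_weight p)) = W_ p.
Proof.
move=> p3; have p0 : (0 < p)%N by lia.
have uX : 1 - x \is a GRing.unit by exact: fps_unit1B.
have uXY : 1 - x * y \is a GRing.unit.
  by apply: fps_unit1B; rewrite coef0_fpsM mul0r.
have uXpY : 1 - x ^+ p * y \is a GRing.unit.
  by apply: fps_unit1B; rewrite coef0_fpsM /x coef_fpsXn eq_sym eqn0Ngt p0 mul0r.
have uG := G_unit p.
have Q1 : (1 - x) * (\sum_(1 <= c < p) x ^+ c) = x - x ^+ p.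
  by rewrite -(prednK p0) x_geom.
have T1 : (1 - x) * (1 - G_ p) = x * (1 - x ^+ p).
  by rewrite /G_ opprB addrCA subrr addr0 x_geom exprS; ring.
have GF : G_ p * F_ p = 1 by rewrite /F_ div1r mulrV.
(* The sum over m < p from [comp_gf_borrow] cancels against that in [G_], leaving only 1 - x^p. *)
have GB : G_ p * comp_gf p (borrow_num 1) = x * (1 - x ^+ p).
  have TQ : G_ p = 1 - (\sum_(1 <= c < p) x ^+ c) - x ^+ p.
    by rewrite /G_ big_nat_recr //= opprD addrA.
  rewrite comp_gf_borrow ?subn1 ?prednK //; last lia.
  rewrite expr1 mulrCA mulrDr mulr1 mulrCA mulrV // mulr1 TQ; ring.
have RE := comp_gf_run p3; have FE := comp_gf_full p3.
set B := comp_gf p run_weight in RE *; set C := comp_gf p (full_weight p) in FE *.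
set b := comp_gf p (borrow_num 1) in GB FE *.
set Q := \sum_(1 <= c < p) x ^+ c in Q1 *.
set g := G_ p in uG T1 GF GB *; set P := x ^+ p in uXpY Q1 T1 GB FE *.
set f := F_ p in RE GF.
have uD : (1 - x) * (1 - x * y) * (1 - P * y) * g \is a GRing.unit.
  by rewrite !unitrM uX uXY uXpY uG.
rewrite /W_ [x ^+ p.+1]exprS -/P -/g; apply: (mulIr uD); rewrite mulrVK //.
(* After clearing the denominator, terms are grouped into the products whose values [Q1], [RE] and
   [FE] give. *)
transitivity ((1 - x) * Q * y * (g * b * ((1 - x * y) * (1 - P * y))
   + x * g * (B * (1 - x * y)) * (1 - P * y) + P * g * (C * (1 - P * y)) * (1 - x * y))).
  by ring.
rewrite RE FE Q1.
(* The grouping isolates g * f = 1, so that (1 - x) * (1 - g) appears and [T1] applies. *)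
transitivity ((x - P) * y * (g * b * ((1 - x * y) * (1 - P * y))
   + x * y * ((1 - x) * (g * f - g)) * (1 - P * y) + P * y * (g * b) * (1 - x * y))).
  by ring.
by rewrite GF T1 GB; ring.
Qed.

Theorem theorem3p7 (p : nat) (hp : (3 <= p)%N) :
  linear_interval_gf p =
    F_ p * (1 + x ^+ 3 * y ^+ 3 * (1 - x ^+ (p - 2)) / (1 - x) + V_ p + W_ p).
Proof.
rewrite linear_interval_gfE //; apply: (mulrI (G_unit p)).
rewrite upper_gf_rec // head_weight_sum // corner_sum // W_sum //.
have GF : G_ p * F_ p = 1 by rewrite /F_ div1r mulrV ?G_unit.
by rewrite [RHS]mulrA GF mul1r; ring.
Qed.
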